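(* Let $2\le k\le n-1$, let $H:(-\varepsilon_0,\varepsilon_0)\to\mathrm{Herm}(n)$ be real-analytic with $H(0)\in\Sigma_k$, and let $r=\mathrm{ord}_0\big(t\mapsto D_k(H(t))\big)$ be the order of energy splitting (computed from the power series with which $D_k(H(t))$ coincides for small $t\ge0$). Let $H_0'\in\Sigma_k$ be any diagonal matrix with nondecreasing diagonal entries such that $H(t)\in\mathcal V_0'$ (the domain of the SW decomposition with respect to $H_0'$) for all $|t|<\delta$, some $\delta>0$, and let $H_{\mathrm{eff}}(t)$ be the effective Hamiltonian of $H(t)$ with respect to $H_0'$, with coordinates $y_1(t),\dots,y_{k^2-1}(t)$. Then $$r=\mathrm{ord}_0\big(t\mapsto d(H(t),\Sigma_k)\big)=\mathrm{ord}_0\big(t\mapsto H_{\mathrm{eff}}(t)\big)=\min_{1\le j\le k^2-1}\mathrm{ord}_0\big(t\mapsto y_j(t)\big).$$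
   Context: $\mathrm{Herm}(n)$: $n\times n$ complex Hermitian matrices, Frobenius norm $\|H\|=\sqrt{\mathrm{tr}H^2}$, $d(H,G)=\|H-G\|$, $d(H,A)=\inf_{G\in A}d(H,G)$. Eigenvalues $\lambda_1(H)\le\dots\le\lambda_n(H)$; $\Sigma_k=\{H:\lambda_1=\dots=\lambda_k<\lambda_{k+1}\}$; $D_k(H)=\sqrt{\frac1k\sum_{j=1}^k(\lambda_j-\bar\lambda)^2}$ with $\bar\lambda=\frac1k\sum_{j\le k}\lambda_j$. For a function $g$ coinciding on $[0,\varepsilon)$ with a convergent power series $\sum a_mt^m$, $\mathrm{ord}_0(g)=\min\{m:a_m\ne0\}$ ($\infty$ if none); for a matrix-valued function the order is the minimum of the orders of its entries. A matrix is block diagonal if $M_{ab}=0$ whenever $a\le k<b$ or $b\le k<a$, and off-block if $M_{ab}=0$ whenever $a,b\le k$ or $a,b>k$. SW decomposition: for a diagonal $H_0\in\Sigma_k$ with nondecreasing diagonal, there are open neighborhoods $\mathcal V_0$ of $H_0$ and $\mathcal U_0$ of $(0,0)$ in the space of pairs ($S$ off-block Hermitian, $\breve B$ block-diagonal Hermitian) such that every $H\in\mathcal V_0$ can be written uniquely as $H=e^{iS}(H_0+\breve B)e^{-iS}$ with $(S,\breve B)\in\mathcal U_0$, where the first $k$ columns of $e^{iS}$ span the sum of the eigenspaces of $H$ for its lowest $k$ eigenvalues; $S,\breve B$ depend real-analytically on $H$. Writing $\breve B=B+T+H_{\mathrm{eff}}$ with $B$ supported in the lower-right $(n-k)\times(n-k)$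 block, $T=c\,\mathrm{diag}(1,\dots,1,0,\dots,0)$ ($k$ ones), and $H_{\mathrm{eff}}$ supported in the upper-left $k\times k$ block with trace $0$, $H_{\mathrm{eff}}$ is the effective Hamiltonian; $y_1,\dots,y_{k^2-1}$ are its coordinates in a fixed orthonormal (Frobenius) basis of the traceless Hermitian matrices supported in the upper-left $k\times k$ block. *)

(* Defs.v *)
(* mathcomp 2.5 + mathcomp-analysis 1.16 + real_closed's complex numbers. *)
From HB Require Import structures.
From mathcomp Require Import all_boot all_order all_algebra.
From mathcomp Require Import all_classical all_reals all_analysis.
From mathcomp Require Import complex.
Set Implicit Arguments. Unset Strict Implicit. Unset Printing Implicit Defensive.
Import Order.TTheory GRing.Theory Num.Theory.
Import numFieldTopology.Exports numFieldNormedType.Exports.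
Local Open Scope ring_scope.
Local Open Scope classical_set_scope.
Local Open Scope complex_scope.

(* The complex numbers over a real field R, seen as a numFieldType (so that the
   topology of MathComp-Analysis applies to it). *)
Definition Cx (R : realType) : numFieldType := R[i].

Section Defs.
Variable R : realType.
Local Notation C := (Cx R).

(* ---------- Hermitian matrices, Frobenius norm, eigenvalues ---------- *)

Definition herm_mx n (A : 'M[C]_n) : Prop := map_mx (fun z : C => z^*) A^T = A.

(* Frobenius norm ||A|| = sqrt (tr A^2) (A Hermitian, so tr A^2 is real >= 0) *)
Definition frob n (A : 'M[C]_n) : R := Num.sqrt (complex.Re (\tr (A *m A))).

(* eigenvalues of a Hermitian matrix, with multiplicity, in nondecreasing order:
   the sorted real sequence whose associated monic polynomial is the
   characteristic polynomial (unique when it exists). *)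
Definition eigs n (A : 'M[C]_n) : seq R :=
  match pselect (exists s : seq R, sorted <=%R s /\
           char_poly A = \prod_(x <- s) ('X - (x%:C : C)%:P)) with
  | left e => projT1 (cid e)
  | right _ => [::]
  end.

(* lam A j = lambda_{j+1}(A)  (0-indexed) *)
Definition lam n (A : 'M[C]_n) (j : nat) : R := nth 0 (eigs A) j.

(* Sigma_k : lambda_1 = ... = lambda_k < lambda_{k+1} *)
Definition Sigma n (k : nat) : set 'M[C]_n :=
  [set G | herm_mx G /\ (forall j, (j < k)%N -> lam G j = lam G 0)
                       /\ lam G k.-1 < lam G k].

(* d(H, A) = inf_{G in A} ||H - G|| *)
Definition dist_set n (H : 'M[C]_n) (A : set 'M[C]_n) : R :=
  inf [set frob (H - G) | G in A].

(* D_k(H) *)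
Definition Dk n (k : nat) (H : 'M[C]_n) : R :=
  let m := k%:R^-1 * \sum_(j < k) lam H j in
  Num.sqrt (k%:R^-1 * \sum_(j < k) (lam H j - m) ^+ 2).

(* ---------- power series, order at 0, real-analyticity ---------- *)

Definition psum (K : numFieldType) (a : nat -> K) (x : K) : nat -> K :=
  fun N => \sum_(i < N) a i * x ^+ i.

(* orders live in nat + {infinity}; None stands for infinity *)
Definition first_nz (K : numFieldType) (a : nat -> K) (m : option nat) : Prop :=
  match m with
  | Some j => a j != 0 /\ (forall i, (i < j)%N -> a i = 0)
  | None => forall i, a i = 0
  end.

(* [has_ord0 c g m]: g coincides on [0, eps) (for some eps > 0) with a convergent
   power series sum_i a_i t^i, and m = ord_0(g) = min {i | a_i <> 0}.
   c : R -> K embeds the real variable t into the coefficient field K. *)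
Definition has_ord0 (K : numFieldType) (c : R -> K) (g : R -> K) (m : option nat) : Prop :=
  exists (a : nat -> K) (eps : R), 0 < eps /\
    (forall t, 0 <= t < eps -> psum a (c t) @ \oo --> g t) /\ first_nz a m.

Definition omin (x y : option nat) : option nat :=
  match x, y with
  | None, _ => y
  | _, None => x
  | Some a, Some b => Some (minn a b)
  end.

(* order of a matrix-valued function: minimum of the orders of its entries *)
Definition mx_ord0 n (M : R -> 'M[C]_n) (m : option nat) : Prop :=
  exists rr : 'I_n -> 'I_n -> option nat,
    (forall i j, has_ord0 (fun t : R => (t%:C : C)) (fun t => M t i j) (rr i j)) /\
    m = \big[omin/None]_(i < n) \big[omin/None]_(j < n) rr i j.

(* real-analytic on the open interval (a, b) *)
Definition analytic_on (K : numFieldType) (c : R -> K) (g : R -> K) (a b : R) : Prop :=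
  forall t0, a < t0 < b -> exists (co : nat -> K) (r : R), 0 < r /\
    forall t, a < t < b -> `|t - t0| < r -> psum co (c (t - t0)) @ \oo --> g t.

Definition mx_analytic n (M : R -> 'M[C]_n) (a b : R) : Prop :=
  forall i j, analytic_on (fun t : R => (t%:C : C)) (fun t => M t i j) a b.

(* ---------- matrix exponential, block structure, SW decomposition ---------- *)

Definition expmx n (A : 'M[C]_n) : 'M[C]_n :=
  \matrix_(i, j) lim ((fun N => (\sum_(m < N) ((m`!)%:R : C)^-1 *: A ^+ m) i j) @ \oo).

(* 0-indexed: index a is in the first block iff a < k *)
Definition offblock n (k : nat) (M : 'M[C]_n) : Prop :=
  forall a b : 'I_n, (a < k)%N = (b < k)%N -> M a b = 0.
Definition blockdiag n (k : nat) (M : 'M[C]_n) : Prop :=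
  forall a b : 'I_n, (a < k)%N != (b < k)%N -> M a b = 0.
Definition ulsupp n (k : nat) (M : 'M[C]_n) : Prop :=
  forall a b : 'I_n, ~~ ((a < k)%N && (b < k)%N) -> M a b = 0.

(* diagonal with nondecreasing (real) diagonal entries *)
Definition diag_nondecr n (M : 'M[C]_n) : Prop :=
  herm_mx M /\ (forall a b : 'I_n, a != b -> M a b = 0) /\
  (forall a b : 'I_n, (a <= b)%N -> complex.Re (M a a) <= complex.Re (M b b)).

(* sum of the eigenspaces of H for its lowest k eigenvalues, as a row space of
   (transposed) column vectors: v *m H^T = l v  <->  H v^T = l v^T *)
Definition lowspace n (k : nat) (H : 'M[C]_n) : 'M[C]_n :=
  (\sum_(j < k) eigenspace H^T (lam H j)%:C)%MS.

(* (S, B) is an SW decomposition of H relative to H0 *)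
Definition SW_ok n (k : nat) (H0 H S B : 'M[C]_n) : Prop :=
  [/\ herm_mx S /\ offblock k S, herm_mx B /\ blockdiag k B,
      H = expmx ('i *: S) *m (H0 + B) *m expmx (- ('i *: S)) &
      (* the first k columns of e^{iS} span the lowest-k spectral subspace of H *)
      ((expmx ('i *: S) *m (pid_mx k : 'M[C]_n))^T == lowspace k H)%MS ].

(* The data of an SW decomposition with respect to H0: open neighbourhoods V0 of
   H0 (in Herm(n)) and U0 of (0,0) (in offblock-Hermitian x blockdiag-Hermitian)
   and the decomposition maps H |-> (SWS H, SWB H), such that every H in V0 is
   written uniquely as e^{iS}(H0+B)e^{-iS} with (S,B) in U0 satisfying the
   eigenspace condition; S and B depend real-analytically on H (assumed here in
   the form: they map real-analytic curves in V0 to real-analytic curves). *)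
Definition SW_data n (k : nat) (H0 : 'M[C]_n) (V0 : set 'M[C]_n)
    (U0 : set ('M[C]_n * 'M[C]_n)) (SWS SWB : 'M[C]_n -> 'M[C]_n) : Prop :=
  [/\ V0 H0 /\ U0 (0, 0),
      (forall G, V0 G -> herm_mx G) /\
      (forall S B, U0 (S, B) -> [/\ herm_mx S, offblock k S, herm_mx B & blockdiag k B]),
      (forall G, V0 G -> exists2 e : R, 0 < e &
          forall G', herm_mx G' -> frob (G' - G) < e -> V0 G') /\
      (forall S B, U0 (S, B) -> exists2 e : R, 0 < e &
          forall S' B', [/\ herm_mx S', offblock k S', herm_mx B' & blockdiag k B'] ->
            frob (S' - S) < e -> frob (B' - B) < e -> U0 (S', B')),
      (forall G, V0 G -> U0 (SWS G, SWB G) /\ SW_ok k H0 G (SWS G) (SWB G)) /\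
      (forall G S B, V0 G -> U0 (S, B) -> SW_ok k H0 G S B -> S = SWS G /\ B = SWB G) &
      (forall (g : R -> 'M[C]_n) (e : R), 0 < e -> mx_analytic g (- e) e ->
          (forall t, - e < t < e -> V0 (g t)) ->
          mx_analytic (fun t => SWS (g t)) (- e) e /\
          mx_analytic (fun t => SWB (g t)) (- e) e) ].

(* effective Hamiltonian: writing B = B' + c diag(1..1,0..0) + Heff with B'
   supported in the lower-right block and Heff traceless supported in the
   upper-left k x k block *)
Definition Heff n (k : nat) (B : 'M[C]_n) : 'M[C]_n :=
  let UL := (pid_mx k : 'M[C]_n) *m B *m pid_mx k in
  UL - (\tr UL / k%:R) *: (pid_mx k : 'M[C]_n).

(* a Frobenius-orthonormal basis of the traceless Hermitian matrices supported in
   the upper-left k x k block (k^2 - 1 orthonormal elements of that real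
   (k^2 - 1)-dimensional space) *)
Definition traceless_onb n (k : nat) (E : 'I_(k ^ 2 - 1) -> 'M[C]_n) : Prop :=
  (forall j, [/\ herm_mx (E j), ulsupp k (E j) & \tr (E j) = 0]) /\
  (forall i j, complex.Re (\tr (E i *m E j)) = (i == j)%:R).

(* coordinate of M along the basis element Ej (Frobenius inner product) *)
Definition coord_along n (Ej M : 'M[C]_n) : R := complex.Re (\tr (Ej *m M)).

End Defs.

(* Main.v *)
(* The condition on the columns of e^{iS} forces lambda_k(H(t)) < lambda_(k+1)(H(t)) for
   all small t, and gives the upper-left block of H_0' + B(t) the same trace, and trace
   of the square, as the restriction of H(t) to its lowest k eigenvectors. As that block
   of H_0' is scalar, ||H_eff(t)||^2 = k D_k(H(t))^2, and the gap gives d(H(t),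
   Sigma_k)^2 = k D_k(H(t))^2 exactly, by a Hoffman-Wielandt type bound. Hence both
   functions are constant multiples of the square root of a sum of squares of the real
   analytic coordinates of H_eff. Factoring out t^r, with r the least order of these
   coordinates, leaves a power series with positive constant term, whose square root is
   again a convergent power series; so the order of both functions is r. The order does
   not depend on the coordinates because a coefficient matrix of H_eff is Hermitian,
   traceless and supported in the block, hence vanishes if and only if all its
   coordinates in the basis do. *)
Require Import Defs.
From HB Require Import structures.
From mathcomp Require Import all_boot all_order all_algebra all_fingroup.
From mathcomp Require Import all_classical all_reals all_analysis.
From mathcomp Require Import complex zify ring lra.
Set Implicit Arguments. Unset Strict Implicit. Unset Printing Implicit Defensive.
Import Order.TTheory GRing.Theory Num.Theory.
Import numFieldTopology.Exports numFieldNormedType.Exports.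
Local Open Scope ring_scope.
Local Open Scope classical_set_scope.

(** * Convergent real power series at 0+ *)

Section PowerSeries.
Variable R : realType.
Implicit Types (a b u : nat -> R) (f g : R -> R).

(** Eigenvalues are given only as a sorted list of roots, with no series attached. They enter
    through their sum and sum of squares over the low block, which are traces; all series come from
    the analytic matrix [SWB (H t)]. The real coordinates whose squares are summed are the numbers
    Re + Im of the entries of [Heff], so the basis [E] matters only at the end, where a dimension
    count shows that it detects every nonzero block. Series are taken on [[0, e)] because the square
    root of [t^(2m)] is [t^m] only for [t >= 0]. The analytic core is the convergence of a formal
    square root: convergence is traded for geometric bounds on coefficients, which can be followed
    through a recurrence. *)

Definition germ a g :=
  exists2 e : R, 0 < e & forall t : R, 0 <= t < e -> psum a t @ \oo --> g t.

(** Such a bound is interchangeable with convergence on some [[0, e)], and it is stable under the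
    operations on coefficients used below. *)
Definition geo_bounded a (C x : R) := forall i, `|a i| <= C * x ^+ i.

Definition cauchy_prod a b n := \sum_(i < n.+1) a i * b (n - i)%N.

Lemma geo_boundedW a C D x y :
  0 <= C <= D -> 0 <= x <= y -> geo_bounded a C x -> geo_bounded a D y.
Proof.
move=> /andP[C0 CD] /andP[x0 xy] ga i; apply: le_trans (ga i) _.
apply: ler_pM => //; first exact: exprn_ge0.
by apply: lerXn2r => //; rewrite nnegrE // (le_trans x0).
Qed.

(** At [t = e / 2] the terms [a i * t ^+ i] tend to 0, hence are bounded; this gives the ratio
    [x = 1 / t]. *)
Lemma germ_geo a g : germ a g -> exists C x : R, [/\ 0 < C, 0 < x & geo_bounded a C x].
Proof.
move=> [e e0 ag]; pose t := e / 2.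
have t0 : 0 < t by rewrite /t; lra.
have cv : cvgn (psum a t).
  by apply/cvg_ex; exists (g t); apply: ag; rewrite /t; apply/andP; split; lra.
have := @cvg_series_cvg_0 R R^o (fun i => a i * t ^+ i).
have -> : series (fun i => a i * t ^+ i) = psum a t.
  by apply/funext => N; rewrite /series /= big_mkord.
move=> /(_ cv) c0.
have cv0 : cvgn (fun i => a i * t ^+ i : R^o) by apply/cvg_ex; exists 0.
have [M [_ bM]] := cvg_seq_bounded cv0.
exists (`|M| + 1), t^-1; split; first by have := normr_ge0 M; lra.
  by rewrite invr_gt0.
move=> i; rewrite exprVn -ler_pdivrMr ?invr_gt0 ?exprn_gt0 // invrK.
have M1 : M < `|M| + 1 by have := ler_norm M; lra.
by have := bM _ M1 i I; rewrite /= normrM (ger0_norm (exprn_ge0 _ (ltW t0))).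
Qed.

Lemma geo_germ a C x : 0 < C -> 0 < x -> geo_bounded a C x ->
  germ a (fun t => limn (psum a t)).
Proof.
move=> C0 x0 ga; exists x^-1; first by rewrite invr_gt0.
move=> t /andP[t0 tx].
suff : cvgn (psum a t) by [].
have -> : psum a t = series (fun i => a i * t ^+ i).
  by apply/funext => N; rewrite /series /= big_mkord.
apply: (@normed_cvg R R^o).
apply: (@series_le_cvg R _ (geometric C (x * t))) => [i|i|i|] /=.
- exact: normr_ge0.
- by rewrite mulr_ge0 ?exprn_ge0 ?mulr_ge0 // ltW.
- rewrite normrM [`|t ^+ i|]ger0_norm ?exprn_ge0 // exprMn mulrA.
  by rewrite ler_wpM2r ?exprn_ge0.
- apply: is_cvg_geometric_series; rewrite ger0_norm ?mulr_ge0 // ?ltW //.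
  by rewrite mulrC -ltr_pdivlMr ?div1r.
Qed.

Lemma germ_unique a f g : germ a f -> germ a g ->
  exists2 e : R, 0 < e & forall t : R, 0 <= t < e -> f t = g t.
Proof.
move=> [e e0 af] [d d0 ag]; exists (Num.min e d); first by rewrite lt_min e0.
move=> t /andP[t0]; rewrite lt_min => /andP[te td].
have := ag t; rewrite t0 td => /(_ isT).
by apply: cvg_unique => //; apply: af; rewrite t0.
Qed.

Lemma germ_near a f g (e : R) : 0 < e -> (forall t : R, 0 <= t < e -> f t = g t) ->
  germ a f -> germ a g.
Proof.
move=> e0 fg [d d0 af]; exists (Num.min e d); first by rewrite lt_min e0.
move=> t /andP[t0]; rewrite lt_min => /andP[te td].
by rewrite -fg ?t0 ?te //; apply: af; rewrite t0.
Qed.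

Lemma germ0 : germ (fun=> 0) (fun=> 0).
Proof.
exists 1 => // t _; rewrite [psum _ _](_ : _ = fun=> 0); first exact: cvg_cst.
by apply/funext => N; rewrite /psum big1 // => i _; rewrite mul0r.
Qed.

Lemma germD a b f g : germ a f -> germ b g ->
  germ (fun i => a i + b i) (fun t => f t + g t).
Proof.
move=> [e e0 af] [d d0 bg]; exists (Num.min e d); first by rewrite lt_min e0.
move=> t /andP[t0]; rewrite lt_min => /andP[te td].
have -> : psum (fun i => a i + b i) t = psum a t \+ psum b t.
  by apply/funext => N; rewrite /psum /= -big_split; apply: eq_bigr => i _; rewrite mulrDl.
by apply: cvgD; [apply: af|apply: bg]; rewrite t0.
Qed.

Lemma germZ c a f : germ a f -> germ (fun i => c * a i) (fun t => c * f t).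
Proof.
move=> [e e0 af]; exists e => // t te.
have -> : psum (fun i => c * a i) t = (fun N => c * psum a t N).
  by apply/funext => N; rewrite /psum /= mulr_sumr; apply: eq_bigr => i _; rewrite mulrA.
by apply: cvgMr; apply: af.
Qed.

Lemma germ_sum (I : Type) (s : seq I) (a : I -> nat -> R) (f : I -> R -> R) :
  (forall i, germ (a i) (f i)) ->
  germ (fun n => \sum_(i <- s) a i n) (fun t => \sum_(i <- s) f i t).
Proof.
move=> af; elim: s => [|i s IHs].
  rewrite (_ : (fun _ => _) = fun=> 0); last by apply/funext => n; rewrite big_nil.
  rewrite [X in germ _ X](_ : _ = fun=> 0); last by apply/funext => t; rewrite big_nil.
  exact: germ0.
rewrite (_ : (fun _ => _) = fun n => a i n + \sum_(j <- s) a j n); last first.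
  by apply/funext => n; rewrite big_cons.
rewrite [X in germ _ X](_ : _ = fun t => f i t + \sum_(j <- s) f j t); last first.
  by apply/funext => t; rewrite big_cons.
exact: germD.
Qed.

(** The Cauchy products of index below [N] fill the triangle [i + j < N] of the square of index
    pairs; the opposite corner is the error. *)
Lemma cauchy_prod_square a b N :
  (\sum_(i < N) a i) * (\sum_(j < N) b j) - \sum_(n < N) cauchy_prod a b n
  = \sum_(i < N) \sum_(j < N | (N <= i + j)%N) a i * b j.
Proof.
have -> : \sum_(n < N) cauchy_prod a b n =
          \sum_(i < N) \sum_(j < N | (i + j < N)%N) a i * b j.
  transitivity (\sum_(n < N) \sum_(i < N | (i <= n)%N) a i * b (n - i)%N).
    apply: eq_bigr => n _; rewrite /cauchy_prod (big_ord_widen N (fun i => a i * b (n - i)%N)) //.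
  rewrite (exchange_big_dep xpredT) //=; apply: eq_bigr => i _.
  rewrite -(big_mkord (fun n => (i <= n)%N) (fun n => a i * b (n - i)%N)).
  rewrite -(big_mkord (fun j => (i + j < N)%N) (fun j => a i * b j)).
  rewrite [LHS](@big_cat_nat _ _ _ i 0 N) ?(ltnW (ltn_ord i)) //=.
  rewrite big_nat_cond big1 ?add0r; last by move=> m /andP[/andP[_ mi] /= ]; rewrite leqNgt mi.
  have -> : \sum_(i <= n < N | (i <= n)%N) a i * b (n - i)%N =
            \sum_(0 <= j < N - i) a i * b j.
    rewrite -{1}[nat_of_ord i]add0n big_addn.
    by apply: eq_big => j; rewrite ?leq_addl ?addnK.
  rewrite [RHS](@big_cat_nat _ _ _ (N - i)%N 0 N) ?leq_subr //=.
  have -> : \sum_(N - i <= j < N | (i + j < N)%N) a i * b j = 0.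
    rewrite big_nat_cond big1 // => j /andP[/andP[]]; rewrite leq_subLR => h _ h2.
    by move: h2; rewrite ltnNge h.
  rewrite addr0.
  rewrite big_nat_cond [RHS]big_nat_cond; apply: eq_bigl => j.
  by rewrite ltn_subRL; case: (i + j < N)%N; rewrite ?andbF ?andbT.
rewrite mulr_suml -sumrB; apply: eq_bigr => i _.
rewrite mulr_sumr (bigID (fun j : 'I_N => (i + j < N)%N)) /= addrAC subrr add0r.
by apply: eq_bigl => j; rewrite -leqNgt.
Qed.

Lemma cauchy_prod_psum a b t n : cauchy_prod a b n * t ^+ n =
  cauchy_prod (fun i => a i * t ^+ i) (fun i => b i * t ^+ i) n.
Proof.
rewrite /cauchy_prod mulr_suml; apply: eq_bigr => i _.
by rewrite mulrACA -exprD subnKC // -ltnS.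
Qed.

(** The corner left over by the partial sums has at most [N ^ 2] terms, each at most
    [D ^+ 2 * 4^-1 ^+ N] once [z * t <= 4^-1]. As [N ^ 2 <= 4 * 2 ^ N], the error is at most
    [D ^+ 2 * 4 * 2^-1 ^+ N]. *)
Lemma germM a b f g : germ a f -> germ b g -> germ (cauchy_prod a b) (fun t => f t * g t).
Proof.
move=> af bg.
have [A [x [A0 x0 ga]]] := germ_geo af; have [B [y [B0 y0 gb]]] := germ_geo bg.
pose D := Num.max A B; pose z := Num.max x y.
have D0 : 0 < D by rewrite lt_max A0.
have z0 : 0 < z by rewrite lt_max x0.
have {ga} : geo_bounded a D z.
  by apply: geo_boundedW ga; rewrite ltW //= le_max lexx.
have {gb} : geo_bounded b D z.
  by apply: geo_boundedW gb; rewrite ltW //= le_max lexx orbT.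
move: af bg => [e e0 af] [d d0 bg] gb ga.
exists (Num.min e (Num.min d (4 * z)^-1)).
  by rewrite !lt_min e0 d0 invr_gt0 mulr_gt0.
move=> t /andP[t0]; rewrite !lt_min => /and3P[te td tz].
have zt : z * t <= 4^-1.
  have : t * (4 * z) < 1 by rewrite -ltr_pdivlMr ?div1r // mulr_gt0.
  by lra.
have {af} af : psum a t @ \oo --> f t by apply: af; rewrite t0.
have {bg} bg : psum b t @ \oo --> g t by apply: bg; rewrite t0.
have fg : (psum a t \* psum b t) @ \oo --> f t * g t by exact: cvgM.
pose err N := psum a t N * psum b t N - psum (cauchy_prod a b) t N.
suff err0 : err @ \oo --> (0 : R).
  have : (psum a t \* psum b t - err) @ \oo --> f t * g t - 0 by exact: cvgB.
  rewrite subr0; apply: cvg_trans.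
  apply: near_eq_cvg; apply: nearW => N /=.
  by rewrite !fctE /err subKr.
have bnd N : `|err N| <= D ^+ 2 * 4 * 2^-1 ^+ N.
  have zt0 : 0 <= z * t by rewrite mulr_ge0 // ltW.
  rewrite /err /psum; under [X in _ - X]eq_bigr do rewrite cauchy_prod_psum.
  rewrite cauchy_prod_square.
  have NN : (N ^ 2 <= 4 * 2 ^ N)%N.
    (* Values up to 3 are computed; from there on the square of [N + 1] is at most twice the square
       of [N]. *)
    elim: {err} N => // -[//|[//|[//|N]]] IHN.
    rewrite expnS mulnCA; apply: leq_trans (leq_mul (leqnn 2) IHN).
    rewrite !expnS !expn0 !muln1; nia.
  apply: (@le_trans _ _ (\sum_(i < N) \sum_(j < N) D ^+ 2 * 4^-1 ^+ N)).
    apply: le_trans (ler_norm_sum _ _ _) _; apply: ler_sum => i _.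
    apply: le_trans (ler_norm_sum _ _ _) _.
    rewrite [leRHS](bigID (fun j : 'I_N => (N <= i + j)%N)) /=.
    rewrite -[leLHS]addr0; apply: lerD; last first.
      apply: sumr_ge0 => j _; apply: mulr_ge0; first exact: (exprn_ge0 _ (ltW D0)).
      by apply: exprn_ge0; lra.
    apply: ler_sum => j Nij.
    rewrite !normrM ![`|t ^+ _|]ger0_norm ?exprn_ge0 //.
    apply: (@le_trans _ _ ((D * (z * t) ^+ i) * (D * (z * t) ^+ j))).
      by apply: ler_pM; rewrite ?mulr_ge0 ?exprn_ge0 // exprMn mulrA ler_wpM2r ?exprn_ge0.
    rewrite mulrACA -expr2 -exprD ler_wpM2l ?exprn_ge0 ?(ltW D0) //.
    apply: (@le_trans _ _ (4^-1 ^+ (i + j))).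
      by apply: lerXn2r => //; rewrite nnegrE; lra.
    by apply: ler_wiXn2l => //; lra.
  rewrite !sumr_const card_ord -mulrnA -[leLHS]mulr_natr -!mulrA.
  do 2!apply: (ler_wpM2l (ltW D0)).
  have -> : (4^-1 : R) = 2^-1 * 2^-1 by rewrite -invfM; congr _^-1; ring.
  rewrite exprMn -mulrA [leRHS]mulrC; apply: ler_wpM2l; first by rewrite exprn_ge0 ?invr_ge0.
  rewrite exprVn mulrC ler_pdivrMr ?exprn_gt0 // -natrX -[4]/(4%:R) -natrM ler_nat.
  by rewrite mulnn.
apply/cvgr0Pnorm_le => eps eps0.
have g0 : (fun N => D ^+ 2 * 4 * 2^-1 ^+ N : R) @ \oo --> (0 : R).
  by apply: cvg_geometric; rewrite ger0_norm ?invr_ge0 // invf_lt1 //; lra.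
move/cvgr0Pnorm_le: g0 => /(_ _ eps0); apply: filterS => N /(le_trans _); apply.
by apply: le_trans (bnd N) (ler_norm _).
Qed.

End PowerSeries.

(** * Square roots of convergent power series *)

Section Sqrt.
Variable R : realType.
Implicit Types (a b u : nat -> R) (f g : R -> R).

(** Since [F n] reads only the values below [n], iterating [F] freezes the value at [n] after
    [n + 1] rounds; the solution is the diagonal of the iterates. *)
Lemma course_of_values_rec (T : Type) (x0 : T) (F : nat -> (nat -> T) -> T) :
  (forall n (s s' : nat -> T), (forall i, (i < n)%N -> s i = s' i) -> F n s = F n s') ->
  exists s : nat -> T, forall n, s n = F n s.
Proof.
move=> FE; pose s m := iter m (fun (s : nat -> T) n => F n s) (fun=> x0).
have sE n m m' : (n < m)%N -> (n < m')%N -> s m n = s m' n.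
  elim/ltn_ind: n m m' => n IHn [//|m] [//|m'] nm nm' /=.
  by apply: FE => i ni; apply: IHn => //; apply: leq_trans ni _.
exists (fun n => s n.+1 n) => n /=; apply: FE => i ni.
exact: (sE i n i.+1).
Qed.

(** The equation [cauchy_prod b b n = a n] solved for [b n], which occurs in it with the factor
    [2 * b 0]. *)
Definition sqrt_step a n b :=
  if n is m.+1 then
    (a n - \sum_(i < m) b i.+1 * b (m - i)%N) / (2 * Num.sqrt (a 0%N))
  else Num.sqrt (a 0%N).

Lemma cauchy_prod_recl b m : cauchy_prod b b m.+1 =
  2 * b 0%N * b m.+1 + \sum_(i < m) b i.+1 * b (m - i)%N.
Proof.
rewrite /cauchy_prod big_ord_recl big_ord_recr /= subn0 subnn.
under eq_bigr => i _ do rewrite /bump /= add1n subSS.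
by rewrite /bump /= add1n; ring.
Qed.

Lemma cauchy_prod_sqrt a : 0 < a 0%N -> exists2 b, b 0%N = Num.sqrt (a 0%N) & cauchy_prod b b =1 a.
Proof.
move=> a0; have [n b b' bb'|b bE] := course_of_values_rec 0 (F := sqrt_step a).
  case: n bb' => //= m bb'; congr ((_ - _) / _); apply: eq_bigr => i _.
  by rewrite !bb' //; have := ltn_ord i; lia.
have b0 : b 0%N = Num.sqrt (a 0%N) by rewrite bE.
have sa0 : Num.sqrt (a 0%N) != 0 by rewrite gt_eqF // sqrtr_gt0.
exists b => // -[|m].
  by rewrite /cauchy_prod big_ord_recl big_ord0 addr0 b0 -expr2 sqr_sqrtr // ltW.
by rewrite cauchy_prod_recl b0 [b m.+1]bE /= -mulrA mulrCA; field.
Qed.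

Lemma ler_cauchy_prod_square u N : (forall i, 0 <= u i) ->
  \sum_(n < N) cauchy_prod u u n <= (\sum_(i < N) u i) ^+ 2.
Proof.
move=> u0; rewrite -subr_ge0 expr2 cauchy_prod_square.
by apply: sumr_ge0 => i _; apply: sumr_ge0 => j _; exact: mulr_ge0.
Qed.

Lemma geometric_tail_le (y : R) N : 0 <= y <= 2^-1 -> \sum_(m < N) y ^+ m.+1 <= 2 * y.
Proof.
move=> /andP[y0 y1].
(* The extra term carries the induction: for [y <= 1/2], [2 * y ^+ N.+1] absorbs both the next
   summand and the next extra term. *)
suff : \sum_(m < N) y ^+ m.+1 + 2 * y ^+ N.+1 <= 2 * y.
  by apply: le_trans; rewrite lerDl mulr_ge0 // exprn_ge0.
elim: N => [|N IHN]; first by rewrite big_ord0 add0r expr1.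
rewrite big_ord_recr /=; apply: le_trans IHN; rewrite -addrA lerD2l.
have := exprn_ge0 N.+1 y0; rewrite [y ^+ N.+2]exprS; nra.
Qed.

(* With S_N = \sum_(1 <= i <= N) |b_i| x^i and \sum_(1 <= i) |a_i| x^i <= b_0^2,
   the recurrence gives 2 b_0 S_(N+1) <= b_0^2 + S_N^2, whence S_N <= b_0 for all N. *)
Lemma cauchy_prod_sqrt_tail_le a b (x : R) : 0 <= x -> 0 < b 0%N -> cauchy_prod b b =1 a ->
  (forall N, \sum_(m < N) `|a m.+1| * x ^+ m.+1 <= b 0%N ^+ 2) ->
  forall N, \sum_(m < N) `|b m.+1| * x ^+ m.+1 <= b 0%N.
Proof.
move=> x0 b0 bba aN; pose v m := `|b m.+1| * x ^+ m.+1.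
have v0 m : 0 <= v m by rewrite mulr_ge0 ?exprn_ge0.
have step m : 2 * b 0%N * v m <= `|a m.+1| * x ^+ m.+1 + \sum_(i < m) v i * v (m - i.+1)%N.
  have -> : 2 * b 0%N * v m = `|a m.+1 - \sum_(i < m) b i.+1 * b (m - i)%N| * x ^+ m.+1.
    rewrite -bba cauchy_prod_recl addrK /v !normrM mulrA [`|2|]ger0_norm //.
    by rewrite [`|b 0%N|]ger0_norm // ltW.
  apply: le_trans (ler_wpM2r (exprn_ge0 _ x0) (ler_normB _ _)) _.
  rewrite mulrDl lerD2l; apply: le_trans (ler_wpM2r (exprn_ge0 _ x0) (ler_norm_sum _ _ _)) _.
  rewrite mulr_suml; apply: ler_sum => i _; rewrite /v normrM.
  have im := ltn_ord i.
  have -> : (m - i = (m - i.+1).+1)%N by lia.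
  rewrite [leRHS]mulrACA -exprD le_eqVlt; apply/orP; left; apply/eqP.
  by congr (_ * x ^+ _); lia.
suff : forall N, \sum_(m < N) v m <= b 0%N by [].
elim=> [|N IHN]; first by rewrite big_ord0 ltW.
have S0 : 0 <= \sum_(m < N) v m by apply: sumr_ge0.
have : 2 * b 0%N * \sum_(m < N.+1) v m <= b 0%N ^+ 2 + (\sum_(m < N) v m) ^+ 2.
  rewrite mulr_sumr.
  apply: (@le_trans _ _ (\sum_(m < N.+1) (`|a m.+1| * x ^+ m.+1 +
                                         \sum_(i < m) v i * v (m - i.+1)%N))).
    by apply: ler_sum => m _; exact: step.
  rewrite big_split /=; apply: lerD; first exact: aN.
  rewrite [leLHS]big_ord_recl /= big_ord0 add0r; apply: (le_trans _ (ler_cauchy_prod_square N v0)).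
  by rewrite le_eqVlt; apply/orP; left; apply/eqP; apply: eq_bigr => m _.
nra.
Qed.

(** Close to 0 the tail of [a] is small, which gives the formal root [b] a geometric bound. Its sum
    squares to [g], and it is the nonnegative root because [b 0] dominates the other terms. *)
Lemma germ_sqrt a g : germ a g -> 0 < a 0%N ->
  exists2 b, 0 < b 0%N & germ b (fun t => Num.sqrt (g t)).
Proof.
move=> ag a0; have [b b0 bba] := cauchy_prod_sqrt a0.
have b0_gt0 : 0 < b 0%N by rewrite b0 sqrtr_gt0.
have b02 : b 0%N ^+ 2 = a 0%N by rewrite b0 sqr_sqrtr // ltW.
exists b => //.
have [C [rho [C0 rho0 ga]]] := germ_geo ag.
(* The first bound makes the geometric tail at most [2 * C * (rho * x)], the second makes this at
   most [a 0 = b 0 ^+ 2], as the tail estimate requires. *)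
pose x := Num.min (2 * rho)^-1 (a 0%N / (2 * C * rho)).
have x0 : 0 < x by rewrite lt_min invr_gt0 divr_gt0 // !mulr_gt0.
have y1 : rho * x <= 2^-1.
  have : x <= (2 * rho)^-1 by rewrite ge_min lexx.
  by rewrite -[leRHS]mul1r ler_pdivlMr ?mulr_gt0 //; lra.
have y2 : 2 * C * (rho * x) <= a 0%N.
  have : x <= a 0%N / (2 * C * rho) by rewrite ge_min lexx orbT.
  by rewrite ler_pdivlMr ?mulr_gt0 //; lra.
clearbody x; have y0 : 0 <= rho * x by rewrite mulr_ge0 ?ltW.
have tail := cauchy_prod_sqrt_tail_le (ltW x0) b0_gt0 bba.
have {tail} tail N : \sum_(m < N) `|b m.+1| * x ^+ m.+1 <= b 0%N.
  apply: tail => {}N; rewrite b02; apply: le_trans y2.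
  apply: (@le_trans _ _ (C * \sum_(m < N) (rho * x) ^+ m.+1)).
    rewrite mulr_sumr; apply: ler_sum => m _; rewrite exprMn mulrA.
    by rewrite ler_wpM2r ?exprn_ge0 // ltW.
  by rewrite [2 * C]mulrC -mulrA ler_wpM2l ?(ltW C0) // geometric_tail_le // y0.
have gb : geo_bounded b (b 0%N) x^-1.
  case=> [|m]; first by rewrite expr0 mulr1 ger0_norm // ltW.
  rewrite exprVn ler_pdivlMr ?exprn_gt0 //; apply: le_trans (tail m.+1).
  rewrite big_ord_recr /= lerDr; apply: sumr_ge0 => i _.
  by rewrite mulr_ge0 ?exprn_ge0 // ltW.
have bl := geo_germ b0_gt0 _ gb; have {bl}bl := bl ltac:(by rewrite invr_gt0).
have := germM bl bl; rewrite (funext bba) => al.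
have [e e0 ge] := germ_unique ag al.
have [d d0 bd] := bl.
apply: (@germ_near _ b (fun t => limn (psum b t)) _ (Num.min e (Num.min d x))) => //.
  by rewrite !lt_min e0 d0 x0.
move=> t /andP[t0]; rewrite !lt_min => /and3P[te td tx].
rewrite ge; last by rewrite t0.
rewrite -expr2 sqrtr_sqr ger0_norm //.
(* Nonnegativity of the sum remains: for [t < x] the terms after [b 0] add up to at most [b 0] in
   absolute value. *)
apply: limr_ge; first by apply/cvg_ex; exists (limn (psum b t)); apply: bd; rewrite t0.
apply: nearW => -[|N]; first by rewrite /psum big_ord0.
rewrite /psum big_ord_recl expr0 mulr1 -[X in X <= _](subrr (b 0%N)) lerD2l.
apply: le_trans (_ : - \sum_(m < N) `|b m.+1| * x ^+ m.+1 <= _); first by rewrite lerN2.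
rewrite -sumrN; apply: ler_sum => m _; rewrite lift0.
apply: le_trans (_ : - `|b m.+1 * t ^+ m.+1| <= _); last exact: lerNnormlW.
rewrite lerN2 normrM ler_wpM2l // ger0_norm ?exprn_ge0 //.
by apply: lerXn2r; rewrite ?nnegrE // ltW.
Qed.

End Sqrt.

(** * Orders of vanishing, with infinity *)

Section Order.
Implicit Types (Z : nat -> Prop) (o : option nat).

(** Orders are handled through the indices strictly below them: a minimum then becomes a
    conjunction, and infinity needs no separate treatment. *)
Definition lt_ord l o := if o is Some m then (l < m)%N else true.

(* [o] is the first index at which [Z] fails. *)
Definition is_order Z o := forall l, lt_ord l o <-> forall i, (i <= l)%N -> Z i.

Lemma lt_ord_inj o o' : (forall l, lt_ord l o = lt_ord l o') -> o = o'.
Proof.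
case: o o' => [m|] [m'|] //= E.
- congr Some; apply/eqP; rewrite eqn_leq; apply/andP; split.
    by rewrite leqNgt E ltnn.
  by rewrite leqNgt -E ltnn.
- by have := E m; rewrite ltnn.
- by have := E m'; rewrite ltnn.
Qed.

Lemma is_order_unique Z Z' o o' : (forall i, Z i <-> Z' i) ->
  is_order Z o -> is_order Z' o' -> o = o'.
Proof.
move=> ZZ' Zo Zo'; apply: lt_ord_inj => l; apply/idP/idP.
  by move=> /(Zo l) h; apply/Zo' => i /h /ZZ'.
by move=> /(Zo' l) h; apply/Zo => i /h /ZZ'.
Qed.

Lemma is_order_exists Z : exists o, is_order Z o.
Proof.
have [[m nZm]|AZ] := pselect (exists m, ~ Z m); last first.
  exists None => l; split=> // _ i _; apply: contrapT => nZ; apply: AZ; by exists i.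
have exm : exists m, `[< ~ Z m >] by exists m; apply/asboolP.
exists (Some (ex_minn exm)) => l; case: ex_minnP => p /asboolP nZp pmin /=; split.
  move=> lp i il; apply: contrapT => /asboolP /pmin; lia.
by move=> Zl; rewrite ltnNge; apply/negP => /Zl.
Qed.

Lemma is_order_None Z : is_order Z None <-> forall i, Z i.
Proof. by split=> [h i|h l]; [exact: (h i).1|split]. Qed.

Lemma is_order_Some Z m : is_order Z (Some m) <-> ~ Z m /\ forall i, (i < m)%N -> Z i.
Proof.
split=> [h|[nZm Zlt] l].
  have Zlt i : (i < m)%N -> Z i by move=> im; apply: (h i).1.
  split=> // Zm; have /h : forall i, (i <= m)%N -> Z i.
    by move=> i; rewrite leq_eqVlt => /predU1P[->|/Zlt].
  by rewrite /= ltnn.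
split=> /= [lm i il|Zl]; first by apply: Zlt; exact: leq_ltn_trans lm.
by rewrite ltnNge; apply/negP => /Zl.
Qed.

Lemma is_order_first_nz (K : numFieldType) (a : nat -> K) o :
  is_order (fun i => a i = 0) o <-> first_nz a o.
Proof.
case: o => [m|] /=; last exact: is_order_None.
split=> [/is_order_Some[/eqP]//|[/eqP am a0]]; exact/is_order_Some.
Qed.

Lemma lt_ord_omin l o o' : lt_ord l (omin o o') = lt_ord l o && lt_ord l o'.
Proof. by case: o o' => [m|] [m'|] //=; rewrite ?leq_min ?andbT. Qed.

Lemma is_order_big_omin (I : finType) (Z : I -> nat -> Prop) (f : I -> option nat) :
  (forall i, is_order (Z i) (f i)) ->
  is_order (fun l => forall i, Z i l) (\big[omin/None]_i f i).
Proof.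
move=> Zf l; rewrite (big_morph (lt_ord l) (id1 := true) (id2 := None) (op1 := andb) (lt_ord_omin l) erefl) big_all.
split=> [/allP h i il j|h].
  by apply: (Zf j l).1 => //; apply: h; rewrite mem_index_enum.
by apply/allP => j _; apply/Zf => i /h.
Qed.

End Order.

(** * Order of the square root of a sum of squares *)

Section GermOrder.
Variable R : realType.
Implicit Types (a b p : nat -> R) (f g : R -> R).

Definition shift_coef m a i := if (i < m)%N then 0 : R else a (i - m)%N.

Lemma psum_shift_coef m a t N : psum (shift_coef m a) t (m + N)%N = t ^+ m * psum a t N.
Proof.
rewrite /psum big_split_ord /= big1 ?add0r; last by move=> i _; rewrite /shift_coef ltn_ord mul0r.
rewrite mulr_sumr; apply: eq_bigr => i _.
by rewrite /shift_coef ltnNge leq_addr addKn exprD mulrCA.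
Qed.

Lemma germ_shift_coef m a f : germ a f -> germ (shift_coef m a) (fun t => t ^+ m * f t).
Proof.
move=> [e e0 af]; exists e => // t te.
have : (fun N => t ^+ m * psum a t N) @ \oo --> t ^+ m * f t by apply: cvgMr; exact: af.
rewrite (_ : (fun N => _) = [sequence psum (shift_coef m a) t (N + m)%N]_N) ?cvg_shiftn //.
by apply/funext => N; rewrite /= addnC psum_shift_coef.
Qed.

(** Dropping the first [m] coefficients keeps a geometric bound, with constant [C * x ^+ m].
    Multiplying by [t ^+ m] restores the series [a], which has only one sum. *)
Lemma germ_unshift m a f : germ a f -> (forall i, (i < m)%N -> a i = 0) ->
  exists2 g, germ (fun i => a (i + m)%N) g &
  exists2 e : R, 0 < e & forall t : R, 0 <= t < e -> f t = t ^+ m * g t.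
Proof.
move=> af a0; have [C [x [C0 x0 ga]]] := germ_geo af.
have gag : germ (fun i => a (i + m)%N) (fun t => limn (psum (fun i => a (i + m)%N) t)).
  apply: (@geo_germ _ _ (C * x ^+ m) x) => // [|i]; first by rewrite mulr_gt0 ?exprn_gt0.
  by rewrite -mulrA -exprD addnC; exact: ga.
exists (fun t => limn (psum (fun i => a (i + m)%N) t)) => //.
apply: (@germ_unique _ a) => //.
have {1}-> : a = shift_coef m (fun i => a (i + m)%N).
  apply/funext => i; rewrite /shift_coef; case: ltnP => [/a0 //|mi].
  by rewrite subnK.
exact: germ_shift_coef.
Qed.

(** For [t >= 0] the root of [t ^+ m.*2 * g t] is [t ^+ m] times the root of [g t], and the series
    of [g] starts with the positive coefficient [a m.*2]. *)
Lemma germ_sqrt_order a f m : germ a f -> (forall i, (i < m.*2)%N -> a i = 0) ->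
  0 < a m.*2 -> exists2 b, first_nz b (Some m) & germ b (fun t => Num.sqrt (f t)).
Proof.
move=> af a0 am; have [g ag [e e0 fg]] := germ_unshift af a0.
have [b b0 bg] := germ_sqrt ag am.
exists (shift_coef m b).
  rewrite /= /shift_coef ltnn subnn gt_eqF //; split=> // i im; by rewrite im.
apply: germ_near (germ_shift_coef m bg); first exact: e0.
move=> t /andP[t0 te]; rewrite fg ?t0 // -muln2 exprM sqrtrM ?sqr_ge0 //.
by rewrite sqrtr_sqr ger0_norm ?exprn_ge0.
Qed.

(** If [i + j < 2m], one of the two indices is below [m]; if [i + j = 2m], only [i = j = m]
    escapes. *)
Lemma cauchy_prod_lt_double p m : (forall i, (i < m)%N -> p i = 0) ->
  (forall l, (l < m.*2)%N -> cauchy_prod p p l = 0) /\ cauchy_prod p p m.*2 = p m ^+ 2.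
Proof.
move=> p0; split=> [l lm|].
  rewrite /cauchy_prod big1 // => i _; have il := ltn_ord i.
  have [im|mi] := ltnP i m; first by rewrite p0 // mul0r.
  by rewrite [p (l - i)%N]p0 ?mulr0 //; lia.
have mm : (m < m.*2.+1)%N by lia.
rewrite /cauchy_prod (bigD1 (Ordinal mm)) //= big1 ?addr0.
  by rewrite expr2; congr (_ * p _); lia.
move=> i; rewrite -val_eqE /= => im; have il := ltn_ord i.
have [im'|mi] := ltnP i m; first by rewrite p0 // mul0r.
by rewrite [p (_ - _)%N]p0 ?mulr0 //; lia.
Qed.

(** Squares of reals cannot cancel: the coefficient of index [2m] is [c] times the sum of the
    [p i m ^+ 2], positive because some [p i m] is nonzero. The factor [c] is [1 / k] for [Dk] and 1
    for the distance. *)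
Lemma has_ord0_sqrt_sum_sqr (I : finType) (p : I -> nat -> R) (P : I -> R -> R) c r :
  (forall i, germ (p i) (P i)) -> 0 < c ->
  is_order (fun l => forall i, p i l = 0) r ->
  has_ord0 id (fun t => Num.sqrt (c * \sum_i P i t ^+ 2)) r.
Proof.
move=> pP c0 pr.
pose s l := c * \sum_i cauchy_prod (p i) (p i) l.
have sS : germ s (fun t => c * \sum_i P i t ^+ 2).
  by apply: germZ; apply: germ_sum => i; exact: germM.
case: r pr => [m /is_order_Some[pm p0]|/is_order_None p0].
  have pp i := cauchy_prod_lt_double (fun l lm => p0 l lm i).
  have [l lm||b bm bS] := germ_sqrt_order sS (m := m).
  - by rewrite /s big1 ?mulr0 // => i _; exact: (pp i).1.
  - rewrite /s mulr_gt0 // lt_neqAle eq_sym sumr_ge0 ?andbT; last first.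
      by move=> i _; rewrite (pp i).2 sqr_ge0.
    apply: contra_notN pm; rewrite psumr_eq0; last first.
      by move=> i _; rewrite (pp i).2 sqr_ge0.
    move=> /allP pm i; have := pm i (mem_index_enum _); rewrite (pp i).2 /=.
    by rewrite sqrf_eq0 => /eqP.
  by case: bS => e e0 be; exists b, e.
have s0 : s = fun=> 0.
  apply/funext => l; rewrite /s big1 ?mulr0 // => i _.
  by rewrite /cauchy_prod big1 // => j _; rewrite p0 mul0r.
rewrite s0 in sS; have [e e0 SE] := germ_unique sS (@germ0 R).
have [|d d0 sd] := germ_near e0 _ (@germ0 R) (g := fun t => Num.sqrt (c * \sum_i P i t ^+ 2)).
  by move=> t te; rewrite SE // sqrtr0.
by exists (fun=> 0), d.
Qed.

End GermOrder.

(** * Spectral decomposition of Hermitian matrices *)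

Section Spectral.
Variable R : realType.
Local Notation C := (Cx R).
Local Notation toC x := (Complex x (0 : R) : C).

Lemma conjCxD (x y : C) : conjc (x + y : C) = (conjc x + conjc y : C).
Proof. exact: (rmorphD (@conjc R)). Qed.

Lemma conjCxM (x y : C) : conjc (x * y : C) = (conjc x * conjc y : C).
Proof. exact: (rmorphM (@conjc R)). Qed.

Lemma conjCxN (x : C) : conjc (- x : C) = (- conjc x : C).
Proof. exact: (rmorphN (@conjc R)). Qed.

Lemma conjCx_nat k : conjc (k%:R : C) = (k%:R : C).
Proof. exact: conjc_nat. Qed.

Lemma conjCx_sum (I : Type) (r : seq I) (P : pred I) (F : I -> C) :
  conjc (\sum_(i <- r | P i) F i : C) = \sum_(i <- r | P i) (conjc (F i) : C).
Proof. exact: (rmorph_sum (@conjc R)). Qed.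

Definition hadj m n (A : 'M[C]_(m, n)) : 'M[C]_(n, m) := map_mx (fun z : C => conjc z) A^T.

Lemma hadjE m n (A : 'M[C]_(m, n)) i j : hadj A i j = conjc (A j i).
Proof. by rewrite !mxE. Qed.

Lemma hadjK m n (A : 'M[C]_(m, n)) : hadj (hadj A) = A.
Proof. by apply/matrixP => i j; rewrite !hadjE conjcK. Qed.

Lemma hadjM m n p (A : 'M[C]_(m, n)) (B : 'M[C]_(n, p)) : hadj (A *m B) = hadj B *m hadj A.
Proof.
apply/matrixP => i j; rewrite hadjE !mxE conjCx_sum.
by apply: eq_bigr => l _; rewrite !hadjE conjCxM mulrC.
Qed.

Lemma hadjD m n (A B : 'M[C]_(m, n)) : hadj (A + B) = hadj A + hadj B.
Proof. by apply/matrixP => i j; rewrite !mxE conjCxD. Qed.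

Lemma hadjN m n (A : 'M[C]_(m, n)) : hadj (- A) = - hadj A.
Proof. by apply/matrixP => i j; rewrite !mxE conjCxN. Qed.

Lemma hadjZ m n (c : C) (A : 'M[C]_(m, n)) : hadj (c *: A) = conjc c *: hadj A.
Proof. by apply/matrixP => i j; rewrite !mxE conjCxM. Qed.

Lemma hadj_pid_mx m n r : hadj (pid_mx r : 'M[C]_(m, n)) = pid_mx r.
Proof.
apply/matrixP => i j; rewrite hadjE !mxE conjCx_nat [X in X && _]eq_sym.
by case: eqP => [->|].
Qed.

Lemma herm_hadj n (A : 'M[C]_n) : herm_mx A <-> hadj A = A.
Proof. by []. Qed.

(** Indexed by [nat], so that [lam A] and the indicator of [j < k] serve directly as diagonals. *)
Definition rdiag n (s : nat -> R) : 'M[C]_n := diag_mx (\row_(j < n) toC (s j)).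

Lemma rdiagE n (s : nat -> R) i j : rdiag n s i j = toC (s i) *+ (i == j).
Proof. by rewrite !mxE. Qed.

Lemma hadj_rdiag n s : hadj (rdiag n s) = rdiag n s.
Proof.
apply/matrixP => i j; rewrite hadjE !rdiagE eq_sym; case: eqP => [->|_].
  by rewrite !mulr1n conjc_real.
by rewrite !mulr0n conjc0.
Qed.

(** Unique factorisation fixes the roots up to a permutation, and sortedness fixes the permutation,
    so the choice made inside [eigs] is harmless. *)
Lemma eigs_unique n (A : 'M[C]_n) (s : seq R) : sorted <=%R s ->
  char_poly A = \prod_(x <- s) ('X - (toC x)%:P) -> eigs A = s.
Proof.
move=> ss As; rewrite /eigs; case: pselect => [e|[]]; last by exists s.
case: (cid e) => s' [ss' As'] /=.
have : \prod_(x <- [seq toC x | x <- s']) ('X - x%:P) =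
       \prod_(x <- [seq toC x | x <- s]) ('X - x%:P).
  by rewrite !big_map -As -As'.
move=> /prod_XsubC_eq /perm_map_inj ps.
apply: (sorted_eq le_trans le_anti) => //.
by apply: ps => x y [].
Qed.

Lemma char_poly_similar (F : comNzRingType) n (A D V W : 'M[F]_n) :
  V *m W = 1%:M -> A = V *m D *m W -> char_poly A = char_poly D.
Proof.
move=> VW ->; pose p (M : 'M[F]_n) := map_mx polyC M.
have -> : char_poly (V *m D *m W) = \det (p V *m char_poly_mx D *m p W).
  congr (\det _); rewrite /char_poly_mx mulmxBr mulmxBl -!map_mxM /=.
  by rewrite mul_mx_scalar -scalemxAl -map_mxM VW map_scalar_mx scalemx1.
rewrite !det_mulmx mulrAC -det_mulmx -map_mxM VW map_mx1 det1 mul1r //.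
Qed.

Lemma eigs_similar n (A V W : 'M[C]_n) (s : seq R) : V *m W = 1%:M ->
  sorted <=%R s -> size s = n -> A = V *m rdiag n (nth 0 s) *m W -> eigs A = s.
Proof.
move=> VW ss sn AE; apply: eigs_unique => //.
rewrite (char_poly_similar VW AE) char_poly_trig ?diag_mx_is_trig //.
rewrite (big_nth 0) sn big_mkord; apply: eq_bigr => i _.
by rewrite rdiagE eqxx.
Qed.

(** Unitary diagonalisation yields the eigenvalues in an uncontrolled order; permuting the columns
    of the unitary matrix aligns them with the sorted list. *)
Lemma herm_spectral n (A : 'M[C]_n) : herm_mx A ->
  [/\ sorted <=%R (eigs A), size (eigs A) = n &
   exists V : 'M[C]_n, [/\ hadj V *m V = 1%:M, V *m hadj V = 1%:M &
     A = V *m rdiag n (lam A) *m hadj V]].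
Proof.
move=> hA.
pose A' : 'M[R[i]]_n := A.
have hA' : A' \is hermsymmx.
  by rewrite is_hermitianmxE expr0 scale1r; apply/eqP; rewrite -[LHS]hA.
pose P : 'M[C]_n := spectralmx A'.
have PP : P *m hadj P = 1%:M by have /unitarymxP := spectral_unitarymx A'.
have AE : A = hadj P *m diag_mx (spectral_diag A' : 'rV[C]_n) *m P.
  have /orthomx_spectralP := hermitian_normalmx hA'.
  by rewrite (invmx_unitary (spectral_unitarymx A')).
have spR j : spectral_diag A' 0 j = toC (complex.Re (spectral_diag A' 0 j)).
  have /mxOverP/(_ 0 j) := hermitian_spectral_diag_real hA'.
  by move=> /RRe_real.
pose t := [tuple complex.Re (spectral_diag A' 0 j) | j < n].
have ss : size (sort <=%R t) == n by rewrite size_sort size_tuple.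
have /tuple_permP[p pE] : perm_eq (Tuple ss) t by rewrite /= perm_sort.
pose V := \matrix_(i, j) hadj P i (p j).
have VV : hadj V *m V = 1%:M.
  apply/matrixP => i j; have := congr1 (fun M : 'M[C]_n => M (p i) (p j)) PP.
  rewrite !mxE (inj_eq perm_inj) => <-; apply: eq_bigr => l _.
  by rewrite !mxE conjcK.
have VV' : V *m hadj V = 1%:M by apply: mulmx1C.
have AV : A = V *m rdiag n (nth 0 (sort <=%R t)) *m hadj V.
  rewrite AE; apply/matrixP => i j; rewrite !mxE.
  rewrite (reindex_inj (@perm_inj _ p)) /=; apply: eq_bigr => l _.
  rewrite !mxE; congr (_ * _); last by rewrite conjcK.
  rewrite (bigD1 (p l)) //= [RHS](bigD1 l) //= !big1 ?addr0.
  - rewrite !mxE !eqxx !mulr1n; congr (_ * _).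
    rewrite spR; congr (Complex _ _).
    have -> : sort <=%R t = Tuple ss by [].
    rewrite pE -tnth_nth tnth_mktuple.
    by rewrite tnth_mktuple.
  - by move=> a /negbTE al; rewrite rdiagE al mulr0n mulr0.
  - by move=> a /negbTE al; rewrite [diag_mx _ _ _]mxE al mulr0n mulr0.
have sE : eigs A = sort <=%R t.
  by apply: (eigs_similar VV') AV; rewrite ?(eqP ss) // sort_le_sorted.
split; first by rewrite sE sort_le_sorted.
  by rewrite sE (eqP ss).
by exists V; split=> //; rewrite /lam sE.
Qed.

End Spectral.

(** * Complex limits and the exponential of [i] times a Hermitian matrix *)

Section ComplexLimits.
Variable R : realType.
Local Notation C := (Cx R).
Local Notation toC x := (Complex x (0 : R) : C).
Implicit Types (u : nat -> R) (z : nat -> C).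

Lemma cvg_toC u (l : R) : u @ \oo --> l -> (fun N => toC (u N)) @ \oo --> toC l.
Proof.
move=> /cvgrPdist_lt ul; apply/cvgrPdist_lt => -[e e'] /=.
(* A positive element of [Cx R] has imaginary part 0, so the tolerance is a real number. *)
rewrite ltcE /= => /andP[/eqP -> e0]; have := ul _ e0; apply: filterS => N.
have -> : (toC l - toC (u N) : C) = toC (l - u N) by apply: esym; exact: (rmorphB (real_complex R)).
by rewrite normc_def /= expr0n addr0 sqrtr_sqr ltcR.
Qed.

Lemma cvg_Re z (l : C) : z @ \oo --> l ->
  (fun N => complex.Re (z N)) @ \oo --> complex.Re l.
Proof.
move=> /cvgrPdist_lt zl; apply/cvgrPdist_lt => e e0.
have := zl (toC e); rewrite ltcR => /(_ e0); apply: filterS => N h.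
have := le_lt_trans (normc_ge_Re (l - z N)) h; rewrite ltcR.
by rewrite [complex.Re _](raddfB (@complex.Re R)).
Qed.

Lemma cvg_Im z (l : C) : z @ \oo --> l ->
  (fun N => complex.Im (z N)) @ \oo --> complex.Im l.
Proof.
move=> zl.
have : (fun N => (- 'i%C : C) * z N) @ \oo --> (- 'i%C : C) * l by apply: cvgMr.
have ImE (w : C) : complex.Re ((- 'i%C : C) * w) = complex.Im w.
  by case: w => a b; simpc.
move=> /cvg_Re; rewrite ImE.
by under eq_fun do rewrite ImE.
Qed.

Lemma cvg_Complex u v (l m : R) : u @ \oo --> l -> v @ \oo --> m ->
  (fun N => Complex (u N) (v N) : C) @ \oo --> (Complex l m : C).
Proof.
move=> /cvg_toC ul /cvg_toC vm.
have E (a b : R) : (Complex a b : C) = toC a + ('i%C : C) * toC b.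
  by simpc.
rewrite E (_ : (fun N => _) = (fun N => toC (u N) + ('i%C : C) * toC (v N))).
  by apply: cvgD; [exact: ul|apply: cvgMr; exact: vm].
by apply/funext => N; exact: E.
Qed.

Lemma exp_i_term (d : R) m :
  ((m`!)%:R : C)^-1 * (('i%C : C) * toC d) ^+ m = Complex (cos_coeff d m) (sin_coeff d m).
Proof.
have i2 : ('i%C : C) ^+ 2 = toC (- 1) by rewrite (sqr_i R) [LHS]complexE /=; simpc.
have toCX (x : R) p : toC x ^+ p = toC (x ^+ p) by apply: esym; exact: (rmorphXn (real_complex R)).
have toCM (x y : R) : (toC x : C) * toC y = toC (x * y) by apply: esym; exact: (rmorphM (real_complex R)).
have -> : ((m`!)%:R : C)^-1 = toC (m`!%:R^-1).
  have -> : (m`!%:R : C) = toC m`!%:R by apply: esym; exact: (rmorph_nat (real_complex R)).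
  by apply: esym; exact: (fmorphV (real_complex R)).
have iX : ('i%C : C) ^+ m = if odd m then Complex 0 ((-1) ^+ m.-1./2) else toC ((-1) ^+ m./2).
  rewrite -{1}(odd_double_half m); case: (boolP (odd m)) => om /=.
    rewrite add1n exprS -mul2n exprM i2 toCX.
    have -> : m.-1./2 = m./2 by lia.
    by simpc.
  by rewrite add0n -mul2n exprM i2 toCX.
rewrite exprMn iX toCX /cos_coeff /sin_coeff /= -exprnP.
case: (odd m) => /=; last by rewrite !toCM !mul0r; congr Complex; ring.
have iM (x y : R) : (Complex 0 x : C) * toC y = Complex 0 (x * y).
  by apply/eqP; rewrite eq_complex /= !mul0r !mulr0 !subr0 !add0r !eqxx.
have Mi (x y : R) : (toC x : C) * Complex 0 y = Complex 0 (x * y).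
  by apply/eqP; rewrite eq_complex /= !mul0r !mulr0 !subr0 !addr0 !eqxx.
by rewrite iM Mi !mul0r; congr Complex; ring.
Qed.

(** Euler's formula: by parity of the index, the exponential series splits into those of cosine and
    sine. *)
Lemma cvg_exp_i (d : R) :
  (fun N => \sum_(m < N) ((m`!)%:R : C)^-1 * (('i%C : C) * toC d) ^+ m) @ \oo
    --> (Complex (cos d) (sin d) : C).
Proof.
have E N : \sum_(m < N) ((m`!)%:R : C)^-1 * (('i%C : C) * toC d) ^+ m =
    Complex (series (cos_coeff d) N) (series (sin_coeff d) N).
  rewrite /series /= !big_mkord.
  elim: N => [|N IHN]; first by rewrite !big_ord0.
  by rewrite !big_ord_recr /= IHN exp_i_term.
rewrite (funext E); apply: cvg_Complex.
  by rewrite cos.unlock; exact: is_cvg_series_cos_coeff.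
by rewrite sin.unlock; exact: is_cvg_series_sin_coeff.
Qed.

Lemma cvg_sumC (I : Type) (r : seq I) (z : I -> nat -> C) (l : I -> C) :
  (forall i, z i @ \oo --> l i) ->
  (fun N => \sum_(i <- r) z i N) @ \oo --> \sum_(i <- r) l i.
Proof.
move=> zl; elim: r => [|i r IHr].
  rewrite big_nil (_ : (fun _ => _) = fun=> 0); first exact: cvg_cst.
  by apply/funext => N; rewrite big_nil.
rewrite big_cons (_ : (fun _ => _) = fun N => z i N + \sum_(j <- r) z j N).
  by apply: cvgD; [exact: zl|exact: IHr].
by apply/funext => N; rewrite big_cons.
Qed.

Definition cis (d : R) : C := Complex (cos d) (sin d).

Lemma cisN d : cis d * cis (- d) = 1.
Proof.
apply/eqP; rewrite /cis cosN sinN eq_complex /= mulrN opprK -!expr2 cos2Dsin2 eqxx /=.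
by rewrite mulrN [sin d * _]mulrC addNr.
Qed.

Lemma mx_similarX n (V D W : 'M[C]_n) m : W *m V = 1%:M -> V *m W = 1%:M ->
  (V *m D *m W) ^+ m = V *m D ^+ m *m W.
Proof.
move=> WV VW; elim: m => [|m IHm]; first by rewrite !expr0 mulmx1 VW.
rewrite !exprS IHm -[LHS]/((V *m D *m W) *m (V *m D ^+ m *m W)) -[D * _]/(D *m _).
by rewrite !mulmxA -[_ *m D *m W *m V]mulmxA WV mulmx1.
Qed.

Lemma diag_mxX n (r : 'rV[C]_n) m : diag_mx r ^+ m = diag_mx (\row_j r 0 j ^+ m).
Proof.
elim: m => [|m IHm]; apply/matrixP => i j.
  by rewrite expr0 !mxE expr0.
rewrite exprS IHm -[LHS]/((diag_mx r *m _) i j) mulmx_diag !mxE; case: eqP => [->|//].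
by rewrite !mulr1n exprS.
Qed.

(** In an eigenbasis each entry of the partial sums is a fixed linear combination of scalar
    exponential series, so the entrywise limit reduces to Euler's formula. *)
Lemma expmx_similar n (V S : 'M[C]_n) (d : nat -> R) :
  hadj V *m V = 1%:M -> V *m hadj V = 1%:M -> S = V *m rdiag n d *m hadj V ->
  expmx (('i%C : C) *: S) = V *m diag_mx (\row_(j < n) cis (d j)) *m hadj V.
Proof.
move=> VV VV' ->; apply/matrixP => i j; rewrite mxE; apply/cvg_lim => //.
have -> : ('i%C : C) *: (V *m rdiag n d *m hadj V) =
    V *m diag_mx (\row_(j < n) (('i%C : C) * toC (d j))) *m hadj V.
  rewrite scalemxAl scalemxAr; congr (_ *m _ *m _).
  by apply/matrixP => a b; rewrite !mxE mulrnAr.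
have E N : (\sum_(m < N) ((m`!)%:R : C)^-1 *:
      (V *m diag_mx (\row_(j < n) (('i%C : C) * toC (d j))) *m hadj V) ^+ m) i j =
    \sum_(l < n) V i l * hadj V l j *
      \sum_(m < N) ((m`!)%:R : C)^-1 * (('i%C : C) * toC (d l)) ^+ m.
  rewrite summxE; under [RHS]eq_bigr do rewrite mulr_sumr.
  rewrite [RHS]exchange_big /=; apply: eq_bigr => m _.
  rewrite mx_similarX // diag_mxX mul_mx_diag !mxE mulr_sumr; apply: eq_bigr => l _.
  by rewrite !mxE; ring.
rewrite (funext E) mul_mx_diag !mxE.
rewrite (eq_bigr (fun l => V i l * hadj V l j * cis (d l))); last first.
  by move=> l _; rewrite !mxE; ring.
by apply: cvg_sumC => l; apply: cvgMr; exact: cvg_exp_i.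
Qed.

(** Both [S] and [- S] are diagonal in the same basis, which reduces the claim to
    [cis d * cis (- d) = 1]. *)
Lemma expmx_skew_inv n (S : 'M[C]_n) : herm_mx S ->
  expmx (('i%C : C) *: S) *m expmx (- (('i%C : C) *: S)) = 1%:M.
Proof.
move=> /herm_spectral[_ _ [V [VV VV' SE]]].
have NS : - S = V *m rdiag n (fun j => - lam S j) *m hadj V.
  rewrite {1}SE -mulNmx -mulmxN; congr (_ *m _ *m _); apply/matrixP => i j.
  rewrite !mxE -mulNrn; congr (_ *+ _); apply: esym; exact: (rmorphN (real_complex R)).
rewrite -scalerN (expmx_similar VV VV' SE) (expmx_similar VV VV' NS).
rewrite !mulmxA -[_ *m hadj V *m V]mulmxA VV mulmx1 -[V *m _ *m _]mulmxA mulmx_diag.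
rewrite (_ : diag_mx _ = 1%:M) ?mulmx1 //; apply/matrixP => i j.
by rewrite !mxE cisN.
Qed.

End ComplexLimits.

(** * Traces over the low-energy subspace *)

Section SchriefferWolff.
Variable R : realType.
Local Notation C := (Cx R).
Local Notation toC x := (Complex x (0 : R) : C).

Lemma rdiag_mul n s t : rdiag (R := R) n s *m rdiag n t = rdiag n (fun j => s j * t j).
Proof.
rewrite mulmx_diag; congr diag_mx; apply/rowP => j; rewrite !mxE.
apply: esym; exact: (rmorphM (real_complex R)).
Qed.

Lemma pid_rdiag n k : (pid_mx k : 'M[C]_n) = rdiag n (fun j => (j < k)%N%:R).
Proof.
apply/matrixP => i j; rewrite !mxE val_eqE; case: eqP => [->|] //=.
by rewrite mulr1n; case: (_ < _)%N.
Qed.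

Lemma mxtrace_rdiag n s : \tr (rdiag (R := R) n s) = toC (\sum_(j < n) s j).
Proof.
rewrite mxtrace_diag; under eq_bigr do rewrite mxE.
by apply: esym; exact: (rmorph_sum (real_complex R)).
Qed.

Lemma sum_lt_ord n k (s : nat -> R) : (k <= n)%N ->
  \sum_(j < n) (j < k)%N%:R * s j = \sum_(j < k) s j.
Proof.
move=> kn; rewrite (big_ord_widen n s kn) [RHS]big_mkcond; apply: eq_bigr => j _.
by case: (j < k)%N; rewrite ?mul1r ?mul0r.
Qed.

Lemma mxtrace_pid_rdiag n k s : (k <= n)%N ->
  \tr ((pid_mx k : 'M[C]_n) *m rdiag n s) = toC (\sum_(j < k) s j).
Proof. by move=> kn; rewrite pid_rdiag rdiag_mul mxtrace_rdiag sum_lt_ord. Qed.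

Lemma mxtrace_pid n k : (k <= n)%N -> \tr (pid_mx k : 'M[C]_n) = k%:R.
Proof.
move=> kn; rewrite pid_rdiag mxtrace_rdiag.
under eq_bigr do rewrite -[_%:R]mulr1.
rewrite (sum_lt_ord (fun=> 1) kn) sumr_const card_ord.
exact: (rmorph_nat (real_complex R)).
Qed.

Section Spectral.
Variables (n k : nat) (A V : 'M[C]_n).
Hypotheses (k_gt0 : (0 < k)%N) (kn : (k < n)%N) (hA : herm_mx A).
Hypotheses (VV : hadj V *m V = 1%:M) (VV' : V *m hadj V = 1%:M)
  (AE : A = V *m rdiag n (lam A) *m hadj V).

Local Notation P := (pid_mx k : 'M[C]_n).

Lemma eigenvector_col (j : 'I_n) : (col j V)^T *m A^T = toC (lam A j) *: (col j V)^T.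
Proof.
rewrite -trmx_mul -linearZ; congr trmx.
rewrite {1}AE -!mulmxA; have -> : hadj V *m col j V = delta_mx j 0.
  by rewrite colE mulmxA VV mul1mx.
have -> : rdiag n (lam A) *m delta_mx j (0 : 'I_1) = toC (lam A j) *: delta_mx j 0 :> 'cV[C]_n.
  apply/matrixP => a b; rewrite mul_diag_mx !mxE; case: eqP => [->|_] //=.
  by rewrite !mulr0.
by rewrite -scalemxAr -colE.
Qed.

(** Transposes appear because [lowspace] is a row space. Only an inclusion can be expected before
    the gap is known: if [lam A k.-1 = lam A k], then [lowspace] has rank above [k]. *)
Lemma pid_sub_lowspace : ((V *m P)^T <= lowspace k A)%MS.
Proof.
apply/row_subP => j; rewrite -tr_col colE -mulmxA -colE.
have [jk|kj] := ltnP j k; last first.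
  rewrite (_ : col j P = 0) ?mulmx0 ?trmx0 ?sub0mx //.
  apply/matrixP => a b; rewrite !mxE; case: eqP => //= ->.
  by rewrite ltnNge kj.
have -> : col j P = delta_mx j 0.
  apply/matrixP => a b; rewrite !mxE val_eqE [b]ord1 andbT; case: eqP => //= ->.
  by rewrite jk.
rewrite -colE; apply: (sumsmx_sup (Ordinal jk)) => //.
by apply/eigenspaceP; exact: eigenvector_col.
Qed.

Lemma row_free_spectral : V \in unitmx. Proof. by case/mulmx1_unit: VV'. Qed.

Lemma rank_mul_pid (U : 'M[C]_n) : U \in unitmx -> \rank (U *m P)^T = k.
Proof.
move=> Uu; rewrite trmx_mul tr_pid_mx mxrankMfree ?row_free_unit ?unitmx_tr //.
by rewrite rank_pid_mx // ltnW.
Qed.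

Section Decomposition.
Variables (U W M : 'M[C]_n).
Hypotheses (UW : U *m W = 1%:M) (AM : A = U *m M *m W) (PM : P *m M = M *m P).
Hypothesis UP : ((U *m P)^T == lowspace k A)%MS.

(** The columns of [U *m P] span [lowspace], which therefore has rank [k]; those of [V *m P] lie in
    it and have the same rank. *)
Lemma eqmx_spectral : ((V *m P)^T == (U *m P)^T)%MS.
Proof.
have /eqmxP UPe := UP; have Uu : U \in unitmx by case/mulmx1_unit: UW.
apply/andP; split; first by rewrite UPe; exact: pid_sub_lowspace.
have sub : ((V *m P)^T <= (U *m P)^T)%MS by rewrite UPe; exact: pid_sub_lowspace.
by rewrite -(mxrank_leqif_sup sub) !rank_mul_pid // row_free_spectral.
Qed.

(** Without a gap, the eigenvector of index [k] would lie in [lowspace], which is spanned by the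
    first [k] eigenvectors, all orthogonal to it. *)
Lemma spectral_gap : lam A k.-1 < lam A k.
Proof.
have [sA szA _] := herm_spectral hA.
have k1n : (k.-1 < n)%N by rewrite (leq_ltn_trans (leq_pred k)).
have : lam A k.-1 <= lam A k by apply: (sorted_leq_nth le_trans le_refl) => //; rewrite ?inE ?szA ?leq_pred.
rewrite le_eqVlt => /predU1P[E|//].
have k1k : (k.-1 < k)%N by rewrite prednK.
pose q := Ordinal kn.
have /submx_trans : ((col q V)^T <= lowspace k A)%MS.
  apply: (sumsmx_sup (Ordinal k1k)) => //.
  by apply/eigenspaceP; rewrite eigenvector_col /= E.
have /eqmxP UPe := UP; have /eqmxP UVe := eqmx_spectral.
move=> /(_ _ (V *m P)^T); rewrite UVe UPe submx_refl => /(_ isT) /submxP[Y].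
move=> /(congr1 trmx); rewrite trmxK trmx_mul trmxK => qE.
have : hadj V *m col q V = P *m Y^T by rewrite qE !mulmxA VV mul1mx.
rewrite colE mulmxA VV mul1mx => /matrixP/(_ q 0); rewrite pid_rdiag mul_diag_mx !mxE eqxx.
by rewrite ltnn /= mul0r => /eqP; rewrite oner_eq0.
Qed.

(** [Q] and [Q'] are projections with the same range, so [Q *m Q' = Q'] and [Q' *m Q = Q], and [Q]
    commutes with [X]. By cyclicity tr(QX) = tr(Q'QX) = tr(Q'XQ) = tr(QQ'X) = tr(Q'X). It serves for
    [N = M] and for [N = M *m M]. *)
Lemma mxtrace_block N X : X = U *m N *m W -> P *m N = N *m P ->
  \tr (P *m N) = \tr (P *m (hadj V *m X *m V)).
Proof.
move=> XE PN; have WU : W *m U = 1%:M by apply: mulmx1C.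
pose Q := U *m P *m W; pose Q' := V *m P *m hadj V.
have PP : P *m P = P by rewrite pid_mx_id // ltnW.
have QX : Q *m X = X *m Q.
  rewrite /Q XE !mulmxA -[_ *m W *m U]mulmxA WU mulmx1 -[U *m P *m N]mulmxA PN.
  by rewrite -[U *m N *m W *m U]mulmxA WU mulmx1 !mulmxA.
have /andP[/submxP[Y YE] /submxP[Z ZE]] := eqmx_spectral.
have {}YE : V *m P = U *m P *m Y^T by rewrite -[LHS]trmxK YE trmx_mul trmxK.
have {}ZE : U *m P = V *m P *m Z^T by rewrite -[LHS]trmxK ZE trmx_mul trmxK.
have QQ' : Q *m Q' = Q'.
  rewrite /Q' mulmxA; congr (_ *m _); rewrite YE /Q !mulmxA.
  by rewrite -[_ *m W *m U]mulmxA WU mulmx1 -[U *m P *m P]mulmxA PP.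
have Q'Q : Q' *m Q = Q.
  rewrite /Q mulmxA; congr (_ *m _); rewrite ZE /Q' !mulmxA.
  by rewrite -[_ *m hadj V *m V]mulmxA VV mulmx1 -[V *m P *m P]mulmxA PP.
have -> : \tr (P *m N) = \tr (Q *m X).
  rewrite /Q XE !mulmxA -[_ *m W *m U]mulmxA WU mulmx1 [RHS]mxtrace_mulC !mulmxA WU mul1mx //.
have -> : \tr (P *m (hadj V *m X *m V)) = \tr (Q' *m X).
  by rewrite /Q' -!mulmxA [RHS]mxtrace_mulC !mulmxA.
by rewrite -Q'Q -mulmxA QX mulmxA mxtrace_mulC mulmxA QQ'.
Qed.

Lemma mxtrace_low : \tr (P *m M) = toC (\sum_(j < k) lam A j).
Proof.
rewrite (mxtrace_block AM PM); have -> : hadj V *m A *m V = rdiag n (lam A).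
  by rewrite {1}AE !mulmxA VV mul1mx -mulmxA VV mulmx1.
by rewrite mxtrace_pid_rdiag // ltnW.
Qed.

Lemma mxtrace_low_sqr : \tr (P *m (M *m M)) = toC (\sum_(j < k) lam A j ^+ 2).
Proof.
have WU : W *m U = 1%:M by apply: mulmx1C.
have AAM : A *m A = U *m (M *m M) *m W.
  by rewrite {1 2}AM !mulmxA -[_ *m W *m U]mulmxA WU mulmx1.
rewrite (mxtrace_block AAM) ?mulmxA ?PM -?mulmxA ?PM //.
have -> : hadj V *m (A *m (A *m V)) = rdiag n (fun j => lam A j * lam A j).
  rewrite -rdiag_mul {1 2}AE !mulmxA VV mul1mx -[_ *m hadj V *m V]mulmxA VV mulmx1.
  by rewrite -[_ *m hadj V *m V]mulmxA VV mulmx1.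
by rewrite mxtrace_pid_rdiag // ltnW.
Qed.

End Decomposition.


End Spectral.
End SchriefferWolff.

(** * Norm of the effective Hamiltonian *)

Section EffectiveHamiltonian.
Variable R : realType.
Local Notation C := (Cx R).
Local Notation toC x := (Complex x (0 : R) : C).

Lemma toCB (x y : R) : (toC (x - y) : C) = toC x - toC y.
Proof. exact: (rmorphB (real_complex R)). Qed.

Lemma toCM (x y : R) : (toC (x * y) : C) = toC x * toC y.
Proof. exact: (rmorphM (real_complex R)). Qed.

Lemma toCV (x : R) : (toC x^-1 : C) = (toC x)^-1.
Proof. exact: (fmorphV (real_complex R)). Qed.

Lemma toC_nat m : (toC m%:R : C) = m%:R.
Proof. exact: (rmorph_nat (real_complex R)). Qed.

Variables (n k : nat).
Hypotheses (k_gt0 : (0 < k)%N) (kn : (k < n)%N).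
Local Notation P := (pid_mx k : 'M[C]_n).

Lemma pid_mulK : P *m P = P.
Proof. by rewrite pid_mx_id // ltnW. Qed.

Lemma HeffD (B D : 'M[C]_n) : Heff k (B + D) = Heff k B + Heff k D.
Proof.
rewrite /Heff mulmxDr mulmxDl mxtraceD mulrDl scalerDl.
by rewrite opprD addrACA.
Qed.

Lemma mxtrace_Heff (B : 'M[C]_n) : \tr (Heff k B) = 0.
Proof.
rewrite /Heff raddfB /= mxtraceZ mxtrace_pid; last exact: ltnW.
by rewrite divfK ?subrr // pnatr_eq0 -lt0n.
Qed.

Lemma ulsupp_Heff (B : 'M[C]_n) : ulsupp k (Heff k B).
Proof.
move=> a b ab; rewrite /Heff.
have Pab : P a b = 0.
  rewrite mxE; case: eqP => //= abv; move: ab; rewrite -abv andbb.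
  by move=> /negbTE ->.
rewrite [LHS]mxE [X in _ + X]mxE [X in _ - X]mxE Pab mulr0 subr0.
rewrite pid_rdiag mul_mx_diag mul_diag_mx !mxE.
by move: ab; rewrite negb_and => /orP[] /negbTE ->; rewrite ?mul0r ?mulr0.
Qed.

Lemma hadj_mxtrace (A : 'M[C]_n) : \tr (hadj A) = conjc (\tr A) :> C.
Proof. by rewrite conjCx_sum; apply: eq_bigr => i _; rewrite hadjE. Qed.

Lemma herm_Heff (B : 'M[C]_n) : herm_mx B -> herm_mx (Heff k B).
Proof.
move=> /herm_hadj hB; apply/herm_hadj.
have UL : hadj (P *m B *m P) = P *m B *m P by rewrite !hadjM hadj_pid_mx hB mulmxA.
rewrite /Heff hadjD hadjN hadjZ UL hadj_pid_mx conjCxM; congr (_ - (_ * _) *: _).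
  by rewrite -hadj_mxtrace UL.
by rewrite -toC_nat -toCV conjc_real.
Qed.

Lemma diag_nondecr_eigs (H0 : 'M[C]_n) : diag_nondecr H0 ->
  H0 = rdiag n (lam H0).
Proof.
move=> [/herm_hadj hH [off mono]].
pose s := mkseq (fun j => if insub j is Some i then complex.Re (H0 i i) else 0) n.
have sE (i : 'I_n) : nth 0 s i = complex.Re (H0 i i).
  by rewrite nth_mkseq // valK.
have H0E : H0 = rdiag n (nth 0 s).
  apply/matrixP => i j; rewrite rdiagE; case: eqVneq => [<-|ij]; last by rewrite off.
  rewrite sE; have := congr1 (fun M : 'M[C]_n => complex.Im (M i i)) hH.
  rewrite hadjE; case: (H0 i i) => x y /= yy; congr Complex; lra.
have -> : lam H0 = nth 0 s; last by [].
rewrite /lam (eigs_similar (V := 1%:M) (W := 1%:M) (s := s)) ?mul1mx ?mulmx1 ?size_mkseq //.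
apply/(sortedP 0) => i; rewrite size_mkseq => iS.
have iN : (i < n)%N by apply: ltnW.
by rewrite (sE (Ordinal iN)) (sE (Ordinal iS)) mono.
Qed.

(** The upper-left block of [H0] is [lam H0 0] times the identity, which the trace correction
    removes. *)
Lemma Heff_diag0 (H0 : 'M[C]_n) : diag_nondecr H0 -> Sigma k H0 -> Heff k H0 = 0.
Proof.
move=> /diag_nondecr_eigs H0E [_ [lE _]].
have UL : P *m H0 *m P = toC (lam H0 0) *: P.
  rewrite {1}H0E pid_rdiag !rdiag_mul; apply/matrixP => i j.
  rewrite [RHS]mxE !rdiagE; case: eqP => _; last by rewrite !mulr0n mulr0.
  rewrite !mulr1n -[RHS]toCM; congr Complex.
  by have [/lE ->|] := ltnP i k; rewrite !(mul1r, mulr1, mul0r, mulr0).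
rewrite /Heff UL mxtraceZ mxtrace_pid; last exact: ltnW.
by rewrite mulfK ?subrr // pnatr_eq0 -lt0n.
Qed.

(** Expanding the square of [P *m B] minus [s / k] times [P] gives [q - 2 s^2 / k + s^2 / k]. This
    is the variance formula for the block, to be matched with the same formula for eigenvalues. *)
Lemma mxtrace_sqr_Heff (B : 'M[C]_n) (s q : R) : P *m B = B *m P ->
  \tr (P *m B) = toC s -> \tr (P *m (B *m B)) = toC q ->
  \tr (Heff k B *m Heff k B) = toC (q - s ^+ 2 / k%:R).
Proof.
move=> PB ts tq.
have PBP : P *m B *m P = P *m B by rewrite -mulmxA -PB mulmxA pid_mulK.
have k0 : k%:R != 0 :> C by rewrite pnatr_eq0 -lt0n.
rewrite /Heff PBP ts mulmxBl !mulmxBr -!scalemxAl -!scalemxAr pid_mulK PBP.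
rewrite [P *m (P *m B)]mulmxA pid_mulK !raddfB /= !mxtraceZ mxtrace_pid ?(ltnW kn) //.
have -> : P *m B *m (P *m B) = P *m (B *m B) by rewrite mulmxA PBP mulmxA.
rewrite ts tq toCB toCM toCV toC_nat expr2 toCM; field.
exact: k0.
Qed.

Lemma sum_sqr_sub_mean (l : nat -> R) : let m := k%:R^-1 * \sum_(j < k) l j in
  \sum_(j < k) (l j - m) ^+ 2 = \sum_(j < k) l j ^+ 2 - (\sum_(j < k) l j) ^+ 2 / k%:R.
Proof.
move=> m; have k0 : k%:R != 0 :> R by rewrite pnatr_eq0 -lt0n.
under eq_bigr do rewrite sqrrB.
rewrite big_split sumrB /= sumr_const card_ord sumrMnl -mulr_suml -[m ^+ 2 *+ k]mulr_natr /m; field.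
exact: k0.
Qed.

Lemma SW_spectral (H0 H S B : 'M[C]_n) : diag_nondecr H0 -> Sigma k H0 -> herm_mx H ->
  SW_ok k H0 H S B ->
  let m := k%:R^-1 * \sum_(j < k) lam H j in
  lam H k.-1 < lam H k /\
  complex.Re (\tr (Heff k B *m Heff k B)) = \sum_(j < k) (lam H j - m) ^+ 2.
Proof.
move=> H0d H0S hH [[hS _] [hB bB] HE UP] m.
have UW := expmx_skew_inv hS.
have [sH szH [V [VV VV' HV]]] := herm_spectral hH.
have PM : P *m (H0 + B) = (H0 + B) *m P.
  rewrite mulmxDr mulmxDl; congr (_ + _).
    rewrite (diag_nondecr_eigs H0d) pid_rdiag !rdiag_mul; congr rdiag.
    by apply/funext => j; rewrite mulrC.
  apply/matrixP => i j; rewrite pid_rdiag mul_diag_mx mul_mx_diag !mxE.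
  have [/bB ->|] := boolP ((i < k)%N != (j < k)%N); first by rewrite mulr0 mul0r.
  by rewrite negbK => /eqP ->; rewrite mulrC.
split; first exact: (spectral_gap k_gt0 kn hH VV VV' HV UW UP).
have -> : Heff k B = Heff k (H0 + B) by rewrite HeffD (Heff_diag0 H0d H0S) add0r.
rewrite (mxtrace_sqr_Heff PM (mxtrace_low kn VV VV' HV UW HE PM UP)
  (mxtrace_low_sqr kn VV VV' HV UW HE PM UP)).
by rewrite sum_sqr_sub_mean.
Qed.

End EffectiveHamiltonian.

(** * Distance to the degenerate stratum *)

Section Distance.
Variable R : realType.
Local Notation C := (Cx R).
Local Notation toC x := (Complex x (0 : R) : C).

Definition sqn (z : C) : R := complex.Re z ^+ 2 + complex.Im z ^+ 2.

Lemma sqn_ge0 z : 0 <= sqn z.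
Proof. by rewrite addr_ge0 ?sqr_ge0. Qed.

Lemma mul_conj_sqn (z : C) : z * conjc z = toC (sqn z).
Proof. by case: z => x y; apply/eqP; rewrite eq_complex /sqn /=; apply/andP; split; apply/eqP; ring. Qed.

Lemma mxtrace_mul_hadj m n (K : 'M[C]_(m, n)) :
  \tr (K *m hadj K) = toC (\sum_i \sum_j sqn (K i j)).
Proof.
rewrite [RHS](rmorph_sum (real_complex R)); apply: eq_bigr => i _.
rewrite [RHS](rmorph_sum (real_complex R)) mxE; apply: eq_bigr => j _.
by rewrite hadjE mul_conj_sqn.
Qed.

(* The dual certificate u_i + v_j <= (l_i - mu_j)^2 of a transport problem over
   doubly stochastic weights replaces the Hoffman-Wielandt inequality. *)
Lemma doubly_stochastic_le n k (w : 'I_n -> 'I_n -> R) (l mu : nat -> R) (c : R) :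
  (0 < k)%N -> (k < n)%N ->
  (forall i j, 0 <= w i j) -> (forall i, \sum_j w i j = 1) -> (forall j, \sum_i w i j = 1) ->
  (forall i j : nat, (i <= j < n)%N -> l i <= l j) ->
  (forall j : nat, (j < k)%N -> mu j = c) -> (forall j : nat, (k <= j < n)%N -> c <= mu j) ->
  \sum_(j < k) (l j - c) ^+ 2 <= \sum_(i < n) \sum_(j < n) (l i - mu j) ^+ 2 * w i j.
Proof.
move=> k0 kn w0 wr wc lmono muc cmu.
(* In the dual solution, [V] adds [v] on the [k] degenerate levels and [U] subtracts it on the [k]
   lowest eigenvalues, so the total is the left-hand side. The truncation at 0 covers the case
   [l k.-1 < c]. *)
pose v := Num.max 0 (l k.-1 - c) ^+ 2.
pose U i := if (i < k)%N then (l i - c) ^+ 2 - v else 0.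
pose V j := if (j < k)%N then v else 0.
have sqr_mono (a b : R) : 0 <= a -> a <= b -> a ^+ 2 <= b ^+ 2.
  by move=> a0 ab; rewrite ler_sqr // nnegrE // (le_trans a0).
have UV (i j : 'I_n) : U i + V j <= (l i - mu j) ^+ 2.
  have ub : (i < k)%N -> l i <= l k.-1 by move=> ik; apply: lmono; lia.
  have lb : (k <= i)%N -> l k.-1 <= l i by move=> ki; apply: lmono; rewrite ltn_ord; lia.
  rewrite /U /V; case: (ltnP j k) => jk; first rewrite (muc _ jk); last first.
    have {}cmu : c <= mu j by apply: cmu; rewrite jk ltn_ord.
    rewrite addr0; case: ltnP => ik; last exact: sqr_ge0.
    have {}ub := ub ik.
    have far : l i <= c -> (l i - c) ^+ 2 <= (l i - mu j) ^+ 2.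
      by move=> lc; rewrite -[leLHS]sqrrN -[leRHS]sqrrN; apply: sqr_mono; lra.
    rewrite /v maxEle; case: ifP => h; last by move/negbT: h; rewrite -ltNge => h; have := far; lra.
    have [h'|h'] := leP (l i) c.
      by have := far h'; have := sqr_ge0 (l k.-1 - c); lra.
    have : (l i - c) ^+ 2 <= (l k.-1 - c) ^+ 2 by apply: sqr_mono; lra.
    by have := sqr_ge0 (l i - mu j); lra.
  case: ltnP => ik; first by rewrite subrK.
  have {}lb := lb ik; rewrite add0r /v maxEle; case: ifP => h; last by rewrite expr0n sqr_ge0.
  by apply: sqr_mono => //; lra.
apply: (@le_trans _ _ (\sum_(i < n) \sum_(j < n) (U i + V j) * w i j)); last first.
  by apply: ler_sum => i _; apply: ler_sum => j _; rewrite ler_wpM2r.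
have -> : \sum_(i < n) \sum_(j < n) (U i + V j) * w i j = \sum_(i < n) U i + \sum_(j < n) V j.
  under eq_bigr => i _ do (under eq_bigr => j _ do rewrite mulrDl; rewrite big_split /=).
  rewrite big_split /=; congr (_ + _).
    by apply: eq_bigr => i _; rewrite -mulr_sumr wr mulr1.
  by rewrite exchange_big /=; apply: eq_bigr => j _; rewrite -mulr_sumr wc mulr1.
rewrite -!big_mkcond -(big_ord_widen _ (fun i => (l i - c) ^+ 2 - v) (ltnW kn)).
by rewrite -(big_ord_widen _ (fun=> v) (ltnW kn)) -big_split /=; under [leRHS]eq_bigr do rewrite subrK.
Qed.

(** Parallel axis identity: the excess is [k] times the square of [m - c], since the cross term
    vanishes at the mean. *)
Lemma sum_sqr_sub_mean_le k (l : nat -> R) c : (0 < k)%N ->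
  let m := k%:R^-1 * \sum_(j < k) l j in
  \sum_(j < k) (l j - m) ^+ 2 <= \sum_(j < k) (l j - c) ^+ 2.
Proof.
move=> k0 /=; set m := k%:R^-1 * _; have k0' : 0 < k%:R :> R by rewrite ltr0n.
have -> : \sum_(j < k) (l j - c) ^+ 2 =
    \sum_(j < k) (l j - m) ^+ 2 + 2 * (m - c) * (\sum_(j < k) l j - k%:R * m) + k%:R * (m - c) ^+ 2.
  have E j : (l j - c) ^+ 2 = (l j - m) ^+ 2 + 2 * (m - c) * (l j - m) + (m - c) ^+ 2 by ring.
  under eq_bigr do rewrite E.
  by rewrite !big_split /= -mulr_sumr sumrB !sumr_const card_ord !mulr_natl.
have -> : \sum_(j < k) l j - k%:R * m = 0 by rewrite /m mulVKf ?subrr // gt_eqF.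
by rewrite mulr0 addr0 lerDl mulr_ge0 ?sqr_ge0 // ltW.
Qed.

Lemma lam_mono n (A : 'M[C]_n) (i j : nat) : herm_mx A -> (i <= j < n)%N -> lam A i <= lam A j.
Proof.
move=> hA /andP[ij jn]; have [sA szA _] := herm_spectral hA.
by apply: (sorted_leq_nth le_trans le_refl) => //; rewrite inE szA // (leq_ltn_trans ij).
Qed.

Lemma row_sqn_unitary n (W : 'M[C]_n) i : W *m hadj W = 1%:M -> \sum_j sqn (W i j) = 1.
Proof.
move=> /(congr1 (fun M : 'M[C]_n => complex.Re (M i i))).
rewrite !mxE eqxx /= => <-; rewrite (eq_bigr (fun j => toC (sqn (W i j)))); last first.
  by move=> j _; rewrite hadjE mul_conj_sqn.
by rewrite -[X in complex.Re X](rmorph_sum (real_complex R)).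
Qed.

Lemma sqnM x y : sqn (x * y) = sqn x * sqn y.
Proof. by case: x => a b; case: y => c d; rewrite /sqn /=; ring. Qed.

Lemma sqn_conj x : sqn (conjc x) = sqn x.
Proof. by case: x => a b; rewrite /sqn /= sqrrN. Qed.

(** With [W] the unitary change between eigenbases of [A] and [G], the squared distance is the sum
    of [(lam A i - lam G j) ^+ 2 * sqn (W i j)], whose weights are doubly stochastic. The degenerate
    eigenvalue of [G] is then replaced by the mean, which is optimal. *)
Lemma dist_Sigma_lower n k (A G : 'M[C]_n) : (0 < k)%N -> (k < n)%N ->
  herm_mx A -> Sigma k G ->
  let m := k%:R^-1 * \sum_(j < k) lam A j in
  Num.sqrt (\sum_(j < k) (lam A j - m) ^+ 2) <= frob (A - G).
Proof.
move=> k0 kn hA [hG [muc _]] /=; set m := k%:R^-1 * _.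
have [_ _ [U [UU UU' AE]]] := herm_spectral hA.
have [_ _ [V [VV VV' GE]]] := herm_spectral hG.
rewrite /frob; apply: ler_wsqrtr.
have AG : hadj (A - G) = A - G by rewrite hadjD hadjN (herm_hadj _).1 // (herm_hadj _).1.
pose W := hadj U *m V; pose K := rdiag n (lam A) *m W - W *m rdiag n (lam G).
have KE : A - G = U *m K *m hadj V.
  rewrite /K /W mulmxBr mulmxBl; congr (_ - _).
    by rewrite {1}AE !mulmxA -[_ *m V *m hadj V]mulmxA VV' mulmx1.
  by rewrite {1}GE !mulmxA UU' mul1mx.
have -> : complex.Re (\tr ((A - G) *m (A - G))) = \sum_i \sum_j sqn (K i j).
  rewrite -{2}AG {1 2}KE !hadjM hadjK !mulmxA -[_ *m hadj V *m V]mulmxA VV mulmx1.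
  by rewrite mxtrace_mulC !mulmxA UU mul1mx mxtrace_mul_hadj.
have WW : W *m hadj W = 1%:M.
  by rewrite /W hadjM hadjK !mulmxA -[_ *m V *m hadj V]mulmxA VV' mulmx1.
have WW' : hadj W *m hadj (hadj W) = 1%:M by rewrite hadjK; apply: mulmx1C.
apply: le_trans (sum_sqr_sub_mean_le _ (lam G 0) k0) _.
have -> : \sum_i \sum_j sqn (K i j) = \sum_(i < n) \sum_(j < n) (lam A i - lam G j) ^+ 2 * sqn (W i j).
  apply: eq_bigr => i _; apply: eq_bigr => j _.
  have -> : K i j = toC (lam A i - lam G j) * W i j.
    by rewrite mxE mul_diag_mx [X in _ + X]mxE mul_mx_diag !mxE toCB; ring.
  by rewrite sqnM {1}/sqn /= expr0n addr0.
apply: doubly_stochastic_le => //.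
- by move=> i j; exact: sqn_ge0.
- by move=> i; exact: row_sqn_unitary.
- move=> j; rewrite -(row_sqn_unitary j WW'); apply: eq_bigr => i _.
  by rewrite hadjE sqn_conj.
- by move=> i j; exact: lam_mono.
- by move=> j /andP[kj jn]; apply: lam_mono.
Qed.

(** The minimiser keeps the eigenvectors of [A] and averages its [k] lowest eigenvalues; as
    [m <= lam A k.-1 < lam A k], the new list stays sorted and keeps a gap. *)
Lemma dist_Sigma_attained n k (A : 'M[C]_n) : (0 < k)%N -> (k < n)%N ->
  herm_mx A -> lam A k.-1 < lam A k ->
  let m := k%:R^-1 * \sum_(j < k) lam A j in
  exists2 G, Sigma k G & frob (A - G) = Num.sqrt (\sum_(j < k) (lam A j - m) ^+ 2).
Proof.
move=> k0 kn hA gap m.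
have [_ _ [U [UU UU' AE]]] := herm_spectral hA.
pose s := mkseq (fun j => if (j < k)%N then m else lam A j) n.
have sE j : (j < n)%N -> nth 0 s j = if (j < k)%N then m else lam A j.
  by move=> jn; rewrite nth_mkseq.
have mk : m <= lam A k.-1.
  rewrite /m mulrC ler_pdivrMr ?ltr0n // mulr_natr.
  apply: le_trans (_ : \sum_(j < k) lam A k.-1 <= _); last by rewrite sumr_const card_ord.
  by apply: ler_sum => j _; apply: lam_mono => //; have := ltn_ord j; lia.
pose G := U *m rdiag n (nth 0 s) *m hadj U.
have GE : eigs G = s.
  apply: (eigs_similar UU') => //; last by rewrite size_mkseq.
  apply/(sortedP 0) => i; rewrite size_mkseq => iS.
  rewrite (sE i.+1) ?(sE i) ?(ltnW iS) //; case: (ltnP i.+1 k) => h; first by rewrite (ltnW h).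
  case: ltnP => h'; last by apply: lam_mono; rewrite ?leqnSn.
  by apply: le_trans mk _; apply: lam_mono => //; lia.
have hG : herm_mx G by apply/herm_hadj; rewrite /G !hadjM hadjK hadj_rdiag mulmxA.
exists G.
  split=> //; rewrite /lam GE; split.
    by move=> j jk; rewrite !sE ?k0 ?jk //; lia.
  rewrite !sE // ?ltnn; last by lia.
  have -> : (k.-1 < k)%N by lia.
  exact: le_lt_trans mk gap.
rewrite /frob; congr Num.sqrt.
have -> : A - G = U *m rdiag n (fun j => lam A j - nth 0 s j) *m hadj U.
  rewrite {1}AE /G -mulmxBl -mulmxBr; congr (_ *m _ *m _).
  by apply/matrixP => i j; rewrite !mxE toCB mulrnBl.
rewrite !mulmxA -[_ *m hadj U *m U]mulmxA UU mulmx1 mxtrace_mulC !mulmxA UU mul1mx.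
rewrite rdiag_mul mxtrace_rdiag /= -(sum_lt_ord (fun j => (lam A j - m) ^+ 2) (ltnW kn)).
apply: eq_bigr => j _; rewrite sE //; case: ifP => _; first by rewrite mul1r expr2.
by rewrite subrr !mul0r.
Qed.

Lemma dist_set_Sigma n k (A : 'M[C]_n) : (0 < k)%N -> (k < n)%N ->
  herm_mx A -> lam A k.-1 < lam A k ->
  let m := k%:R^-1 * \sum_(j < k) lam A j in
  dist_set A (Sigma k) = Num.sqrt (\sum_(j < k) (lam A j - m) ^+ 2).
Proof.
move=> k0 kn hA gap m; have [G SG GE] := dist_Sigma_attained k0 kn hA gap.
have lb : lbound [set frob (A - G) | G in Sigma k] (Num.sqrt (\sum_(j < k) (lam A j - m) ^+ 2)).
  by move=> _ [G' SG' <-]; exact: dist_Sigma_lower.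
apply/eqP; rewrite eq_le; apply/andP; split.
  rewrite -GE; apply: ge_inf; last by exists G.
  by eexists; exact: lb.
by apply: lb_le_inf => //; exists (frob (A - G)), G.
Qed.

End Distance.

(** * Completeness of orthonormal bases of traceless Hermitian blocks *)

Section HermitianBasis.
Variable R : realType.
Local Notation C := (Cx R).
Local Notation toC x := (Complex x (0 : R) : C).

(* On Hermitian matrices Re is symmetric and Im antisymmetric, so that Re + Im is a
   linear isometry onto real matrices. *)
Definition realify n (M : 'M[C]_n) : 'M[R]_n :=
  \matrix_(i, j) (complex.Re (M i j) + complex.Im (M i j)).

Lemma Re_sum (I : Type) (r : seq I) (F : I -> C) :
  complex.Re (\sum_(i <- r) F i) = \sum_(i <- r) complex.Re (F i).
Proof. exact: (raddf_sum (@complex.Re R)). Qed.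

Lemma herm_mxE n (M : 'M[C]_n) i j : herm_mx M -> M i j = conjc (M j i).
Proof. by move=> /herm_hadj hM; rewrite -{1}hM hadjE. Qed.

(** The product of [realify] entries contains mixed terms Re times Im; for Hermitian matrices these
    are antisymmetric in the indices and sum to 0. *)
Lemma realify_isometry n (M N : 'M[C]_n) : herm_mx M -> herm_mx N ->
  complex.Re (\tr (M *m N)) = \sum_i \sum_j realify M i j * realify N i j.
Proof.
move=> hM hN.
pose X i j := complex.Re (M i j) * complex.Im (N i j).
pose Y i j := complex.Im (M i j) * complex.Re (N i j).
have anti (F : 'I_n -> 'I_n -> R) : (forall i j, F i j = - F j i) -> \sum_i \sum_j F i j = 0.
  move=> FN; apply/eqP; rewrite -[_ == 0](mulrn_eq0 _ 2) mulr2n {1}exchange_big /= -big_split.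
  by rewrite big1 // => i _; rewrite -big_split big1 //= => j _; rewrite FN addNr.
have X0 : \sum_i \sum_j X i j = 0.
  by apply: anti => i j; rewrite /X (herm_mxE i j hM) (herm_mxE i j hN) /=; case: (M j i) (N j i) => a b [c d] /=; ring.
have Y0 : \sum_i \sum_j Y i j = 0.
  by apply: anti => i j; rewrite /Y (herm_mxE i j hM) (herm_mxE i j hN) /=; case: (M j i) (N j i) => a b [c d] /=; ring.
have -> : \sum_i \sum_j realify M i j * realify N i j = \sum_i \sum_j
    (complex.Re (M i j) * complex.Re (N i j) + complex.Im (M i j) * complex.Im (N i j)) +
    \sum_i \sum_j X i j + \sum_i \sum_j Y i j.
  rewrite -!big_split; apply: eq_bigr => i _; rewrite -!big_split; apply: eq_bigr => j _ /=.
  by rewrite !mxE /X /Y; ring.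
rewrite X0 Y0 !addr0 Re_sum; apply: eq_bigr => i _; rewrite mxE Re_sum; apply: eq_bigr => j _.
by rewrite (herm_mxE j i hN); case: (M i j) (N i j) => a b [c d] /=; ring.
Qed.

Lemma realify_eq0 n (M : 'M[C]_n) : herm_mx M -> (forall i j, realify M i j = 0) -> M = 0.
Proof.
move=> hM M0; apply/matrixP => i j; rewrite [RHS]mxE.
have := M0 i j; have := M0 j i; rewrite !mxE (herm_mxE j i hM).
by case: (M i j) => a b /= h1 h2; apply/eqP; rewrite eq_complex /=; apply/andP; split; apply/eqP; lra.
Qed.

Lemma realify_ulsupp n k (M : 'M[C]_n) (i j : 'I_n) : ulsupp k M ->
  ~~ ((i < k)%N && (j < k)%N) -> realify M i j = 0.
Proof. by move=> uM ij; rewrite mxE uM //= addr0. Qed.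

(** Each block, realified, becomes a row of [k ^ 2] real numbers. Orthogonality makes the Gram
    matrix diagonal and invertible, so there are at most as many rows as columns. *)
Lemma orthogonal_family_card n k (kn : (k <= n)%N) (T : finType) (f : T -> 'M[C]_n) :
  (forall x, herm_mx (f x) /\ ulsupp k (f x)) ->
  (forall x y, x != y -> complex.Re (\tr (f x *m f y)) = 0) ->
  (forall x, complex.Re (\tr (f x *m f x)) != 0) ->
  (#|T| <= k ^ 2)%N.
Proof.
move=> hf off diag.
pose w := widen_ord kn.
pose A : 'M[R]_(#|T|, #|{: 'I_k * 'I_k}|) :=
  \matrix_(x, u) realify (f (enum_val x)) (w (enum_val u).1) (w (enum_val u).2).
have gram : A *m A^T = diag_mx (\row_x complex.Re (\tr (f (enum_val x) *m f (enum_val x)))).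
  apply/matrixP => x y; rewrite !mxE.
  transitivity (complex.Re (\tr (f (enum_val x) *m f (enum_val y)))); last first.
    by case: eqVneq => [->//|xy]; rewrite off // (inj_eq enum_val_inj).
  have [hx ux] := hf (enum_val x); have [hy _] := hf (enum_val y).
  rewrite realify_isometry //.
  pose F i j := realify (f (enum_val x)) i j * realify (f (enum_val y)) i j.
  have F0 (i j : 'I_n) : ~~ ((i < k)%N && (j < k)%N) -> F i j = 0.
    by move=> ij; rewrite /F (realify_ulsupp ux ij) mul0r.
  transitivity (\sum_(u : 'I_k * 'I_k) F (w u.1) (w u.2)).
    transitivity (\sum_(u in {: 'I_k * 'I_k}) F (w u.1) (w u.2)).
      by rewrite [RHS]big_enum_val; apply: eq_bigr => u _; rewrite /F !mxE.
    by apply: eq_bigl => u; rewrite inE.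
  rewrite -(pair_bigA _ (fun a b : 'I_k => F (w a) (w b))) /=.
  rewrite [RHS](bigID (fun i : 'I_n => (i < k)%N)) /= [X in _ = _ + X]big1 ?addr0; last first.
    by move=> i /negbTE ik; apply: big1 => j _; apply: F0; rewrite ik.
  rewrite (big_ord_narrow kn) /=; apply: eq_bigr => a _.
  rewrite [RHS](bigID (fun i : 'I_n => (i < k)%N)) /= [X in _ = _ + X]big1 ?addr0; last first.
    by move=> i /negbTE ik; apply: F0; rewrite ik andbF.
  by rewrite (big_ord_narrow kn).
have : \rank (A *m A^T) = #|T|.
  apply: mxrank_unit; rewrite gram unitmxE det_diag unitfE prodf_seq_neq0.
  by apply/allP => x _; rewrite mxE diag.
move=> <-; apply: leq_trans (mxrankM_maxl _ _) _; apply: leq_trans (rank_leq_col _) _.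
by rewrite card_prod card_ord mulnn.
Qed.

(** If [h] were nonzero, the [E j], [h] and the block identity [P], which is orthogonal to traceless
    blocks, would be [k ^ 2 + 1] nonzero orthogonal matrices in a space of real dimension
    [k ^ 2]. *)
Lemma traceless_onb_complete n k (E : 'I_(k ^ 2 - 1) -> 'M[C]_n) (h : 'M[C]_n) :
  (0 < k)%N -> (k <= n)%N -> traceless_onb E ->
  herm_mx h -> ulsupp k h -> \tr h = 0 ->
  (forall j, coord_along (E j) h = 0) -> h = 0.
Proof.
move=> k0 kn [Eprop Eon] hh uh th Eh.
have [hh0|hh0] := eqVneq (complex.Re (\tr (h *m h))) 0.
  apply: realify_eq0 => // i j; move: hh0; rewrite realify_isometry // => /eqP.
  rewrite psumr_eq0 => [/allP/(_ i (mem_index_enum _))|a _]; last by apply: sumr_ge0 => b _; rewrite -expr2 sqr_ge0.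
  rewrite psumr_eq0 => [/allP/(_ j (mem_index_enum _))|b _]; last by rewrite -expr2 sqr_ge0.
  by rewrite /= -expr2 sqrf_eq0 => /eqP.
pose P : 'M[C]_n := pid_mx k.
have hP : herm_mx P by apply/herm_hadj; exact: hadj_pid_mx.
have uP : ulsupp k P.
  move=> a b ab; rewrite mxE; case: eqP => //= abv; move: ab.
  by rewrite -abv andbb => /negbTE ->.
have trP M : ulsupp k M -> \tr (P *m M) = \tr M.
  move=> uM; apply: eq_bigr => i _; rewrite /P pid_rdiag mul_diag_mx !mxE.
  have [|ik] := boolP (i < k)%N; first by rewrite mul1r.
  by rewrite uM ?mulr0 // negb_and ik.
pose f (x : option (option 'I_(k ^ 2 - 1))) :=
  match x with None => P | Some None => h | Some (Some j) => E j end.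
have := @orthogonal_family_card n k kn _ f.
rewrite !card_option card_ord.
have cyc M N : complex.Re (\tr (M *m N)) = complex.Re (\tr (N *m M)) by rewrite mxtrace_mulC.
have PE j : complex.Re (\tr (P *m E j)) = 0.
  by have [_ uE tE] := Eprop j; rewrite trP // tE.
have Ph : complex.Re (\tr (P *m h)) = 0 by rewrite trP // th.
have kk : (0 < k ^ 2)%N by rewrite expn_gt0 k0.
suff H : forall x y, x != y -> complex.Re (\tr (f x *m f y)) = 0.
  move=> /(_ _ H) bad; suff : ((k ^ 2 - 1).+2 <= k ^ 2)%N by lia.
  apply: bad => [[[j|]|]|[[j|]|]] //=; first by have [? ?] := Eprop j.
    by rewrite Eon eqxx oner_eq0.
  by rewrite trP // mxtrace_pid // -toC_nat pnatr_eq0 -lt0n.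
move=> [[i|]|] [[j|]|] //= ij.
- by rewrite Eon (_ : i == j = false) //; apply: contraNF ij => /eqP ->.
- exact: Eh.
- by rewrite cyc.
- by rewrite cyc; exact: Eh.
- by rewrite cyc.
Qed.

End HermitianBasis.

(** * Matrices of convergent power series *)

Section ComplexGerm.
Variable R : realType.
Local Notation C := (Cx R).
Local Notation toC x := (Complex x (0 : R) : C).
Implicit Types (z : nat -> C) (g : R -> C).

Definition cgerm z g :=
  exists2 e : R, 0 < e & forall t : R, 0 <= t < e -> psum z (toC t) @ \oo --> g t.

Lemma cgermD z z' g g' : cgerm z g -> cgerm z' g' ->
  cgerm (fun i => z i + z' i) (fun t => g t + g' t).
Proof.
move=> [e e0 zg] [d d0 zg']; exists (Num.min e d); first by rewrite lt_min e0.
move=> t /andP[t0]; rewrite lt_min => /andP[te td].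
have -> : psum (fun i => z i + z' i) (toC t) = fun N => psum z (toC t) N + psum z' (toC t) N.
  by apply/funext => N; rewrite /psum -big_split; apply: eq_bigr => i _; rewrite mulrDl.
by apply: cvgD; [apply: zg|apply: zg']; rewrite t0.
Qed.

Lemma cgermZ c z g : cgerm z g -> cgerm (fun i => c * z i) (fun t => c * g t).
Proof.
move=> [e e0 zg]; exists e; [exact: e0|move=> t te].
have -> : psum (fun i => c * z i) (toC t) = fun N => c * psum z (toC t) N.
  by apply/funext => N; rewrite /psum mulr_sumr; apply: eq_bigr => i _; rewrite mulrA.
by apply: cvgMr; exact: zg.
Qed.

Lemma cgerm_sum (I : Type) (r : seq I) (z : I -> nat -> C) (g : I -> R -> C) :
  (forall i, cgerm (z i) (g i)) ->
  cgerm (fun l => \sum_(i <- r) z i l) (fun t => \sum_(i <- r) g i t).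
Proof.
move=> zg; elim: r => [|i r IHr].
  exists 1; [exact: ltr01|move=> t _]; rewrite big_nil (_ : psum _ _ = fun=> 0); first exact: cvg_cst.
  by apply/funext => N; rewrite /psum big1 // => l _; rewrite big_nil mul0r.
rewrite (_ : (fun _ => _) = fun l => z i l + \sum_(j <- r) z j l); last first.
  by apply/funext => l; rewrite big_cons.
rewrite [X in cgerm _ X](_ : _ = fun t => g i t + \sum_(j <- r) g j t); last first.
  by apply/funext => t; rewrite big_cons.
exact (cgermD (zg i) IHr).
Qed.

Lemma toCX (x : R) p : toC x ^+ p = toC (x ^+ p).
Proof. by apply: esym; exact: (rmorphXn (real_complex R)). Qed.

Lemma psum_Complex z (t : R) N : psum z (toC t) N =
  Complex (psum (fun i => complex.Re (z i)) t N) (psum (fun i => complex.Im (z i)) t N).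
Proof.
rewrite /psum; elim: N => [|N IHN]; first by rewrite !big_ord0.
rewrite !big_ord_recr /= IHN toCX; case: (z N) => a b /=.
by apply/eqP; rewrite eq_complex /= !mulr0 subr0 add0r !eqxx.
Qed.

Lemma germ_Re z g : cgerm z g -> germ (fun i => complex.Re (z i)) (fun t => complex.Re (g t)).
Proof.
move=> [e e0 zg]; exists e; [exact: e0|move=> t te]; have := cvg_Re (zg t te).
by rewrite (funext (psum_Complex z t)).
Qed.

Lemma germ_Im z g : cgerm z g -> germ (fun i => complex.Im (z i)) (fun t => complex.Im (g t)).
Proof.
move=> [e e0 zg]; exists e; [exact: e0|move=> t te]; have := cvg_Im (zg t te).
by rewrite (funext (psum_Complex z t)).
Qed.

(** The variable [t] is real, so conjugating the coefficients conjugates the sum; this makes the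
    Hermitian part of a matrix series available. *)
Lemma cgerm_conj z g : cgerm z g -> cgerm (fun i => conjc (z i)) (fun t => conjc (g t)).
Proof.
move=> zg; have [e e0 rz] := germ_Re zg; have [d d0 iz] := germZ (-1) (germ_Im zg).
exists (Num.min e d); first by rewrite lt_min e0.
move=> t /andP[t0]; rewrite lt_min => /andP[te td].
rewrite (funext (psum_Complex _ t)).
have -> : conjc (g t) = Complex (complex.Re (g t)) (-1 * complex.Im (g t)).
  by case: (g t) => a b; rewrite mulN1r.
apply: cvg_Complex.
  rewrite (_ : (fun i => complex.Re (conjc (z i))) = fun i => complex.Re (z i)).
    by apply: rz; rewrite t0.
  by apply/funext => i; case: (z i).
rewrite (_ : (fun i => complex.Im (conjc (z i))) = fun i => -1 * complex.Im (z i)).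
  by apply: iz; rewrite t0.
by apply/funext => i; case: (z i) => a b; rewrite mulN1r.
Qed.

Definition mgerm m n (h : nat -> 'M[C]_(m, n)) (M : R -> 'M[C]_(m, n)) :=
  forall i j, cgerm (fun l => h l i j) (fun t => M t i j).

Lemma cgerm_ext z z' g g' : z =1 z' -> g =1 g' -> cgerm z g -> cgerm z' g'.
Proof. by move=> /funext -> /funext ->. Qed.

Lemma mgermD m n h h' (M M' : R -> 'M[C]_(m, n)) : mgerm h M -> mgerm h' M' ->
  mgerm (fun l => h l + h' l) (fun t => M t + M' t).
Proof.
by move=> hM hM' i j; apply: cgerm_ext (cgermD (hM i j) (hM' i j)) => l; rewrite mxE.
Qed.

Lemma mgermZ m n c h (M : R -> 'M[C]_(m, n)) : mgerm h M ->
  mgerm (fun l => c *: h l) (fun t => c *: M t).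
Proof. by move=> hM i j; apply: cgerm_ext (cgermZ c (hM i j)) => l; rewrite mxE. Qed.

Lemma mgerm_scale m n z g (X : 'M[C]_(m, n)) : cgerm z g ->
  mgerm (fun l => z l *: X) (fun t => g t *: X).
Proof.
by move=> zg i j; apply: cgerm_ext (cgermZ (X i j) zg) => l; rewrite mxE mulrC.
Qed.

Lemma mgerm_hadj m n h (M : R -> 'M[C]_(m, n)) : mgerm h M ->
  mgerm (fun l => hadj (h l)) (fun t => hadj (M t)).
Proof. by move=> hM i j; apply: cgerm_ext (cgerm_conj (hM j i)) => l; rewrite hadjE. Qed.

Lemma mgerm_mull m n p (X : 'M[C]_(p, m)) h (M : R -> 'M[C]_(m, n)) : mgerm h M ->
  mgerm (fun l => X *m h l) (fun t => X *m M t).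
Proof.
move=> hM i j; apply: cgerm_ext (cgerm_sum _ (fun a => cgermZ (X i a) (hM a j))) => l;
  by rewrite mxE.
Qed.

Lemma mgerm_mulr m n p (X : 'M[C]_(n, p)) h (M : R -> 'M[C]_(m, n)) : mgerm h M ->
  mgerm (fun l => h l *m X) (fun t => M t *m X).
Proof.
move=> hM i j; apply: cgerm_ext (cgerm_sum _ (fun a => cgermZ (X a j) (hM i a))) => l;
  by rewrite mxE; apply: eq_bigr => a _; rewrite mulrC.
Qed.

Lemma cgerm_mxtrace n h (M : R -> 'M[C]_n) : mgerm h M ->
  cgerm (fun l => \tr (h l)) (fun t => \tr (M t)).
Proof. by move=> hM; apply: cgerm_sum => i; exact: hM. Qed.

(** [Heff k] is complex linear, hence acts coefficient by coefficient. *)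
Lemma mgerm_Heff n k h (M : R -> 'M[C]_n) : mgerm h M ->
  mgerm (fun l => Heff k (h l)) (fun t => Heff k (M t)).
Proof.
move=> hM; have UL := mgerm_mulr (pid_mx k : 'M[C]_n) (mgerm_mull (pid_mx k : 'M[C]_n) hM).
have := mgermD UL (mgermZ (- 1) (mgerm_scale (pid_mx k : 'M[C]_n) (cgermZ (k%:R^-1) (cgerm_mxtrace UL)))).
move=> H i j; apply: cgerm_ext (H i j) => l;
  by rewrite /Heff scaleN1r [_ / _]mulrC.
Qed.

End ComplexGerm.

(** * From coefficient sequences to orders of functions *)

Section Orders.
Variable R : realType.
Local Notation C := (Cx R).
Local Notation toC x := (Complex x (0 : R) : C).

Lemma is_order_ext (Z Z' : nat -> Prop) o :
  (forall i, Z i <-> Z' i) -> is_order Z o -> is_order Z' o.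
Proof. by move=> ZZ' Zo l; rewrite Zo; split=> h i /h /ZZ'. Qed.

Lemma has_ord0_near (K : numFieldType) (c : R -> K) (f g : R -> K) (e : R) o : 0 < e ->
  (forall t, 0 <= t < e -> f t = g t) -> has_ord0 c f o -> has_ord0 c g o.
Proof.
move=> e0 fg [a [d [d0 [af ao]]]]; exists a, (Num.min e d); rewrite lt_min e0; split=> //.
split=> // t /andP[t0]; rewrite lt_min => /andP[te td].
by rewrite -fg ?t0 //; apply: af; rewrite t0.
Qed.

Lemma germ_has_ord0 (a : nat -> R) f o : germ a f -> is_order (fun i => a i = 0) o ->
  has_ord0 id f o.
Proof. by move=> [e e0 af] /is_order_first_nz ao; exists a, e. Qed.

Lemma cgerm_has_ord0 (z : nat -> C) g o : cgerm z g -> is_order (fun i => z i = 0) o ->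
  has_ord0 (fun t : R => real_complex R t : C) g o.
Proof. by move=> [e e0 zg] /is_order_first_nz zo; exists z, e. Qed.

End Orders.

(** * Series of the effective Hamiltonian with Hermitian coefficients *)

Section HeffGerm.
Variable R : realType.

Lemma germ_ext (a a' : nat -> R) (f f' : R -> R) : a =1 a' -> f =1 f' -> germ a f -> germ a' f'.
Proof. by move=> /funext -> /funext ->. Qed.

Local Notation C := (Cx R).

Lemma analytic_cgerm (g : R -> C) (e : R) : 0 < e ->
  analytic_on (fun t : R => real_complex R t : C) g (- e) e -> exists z, cgerm z g.
Proof.
move=> e0 /(_ 0); rewrite oppr_lt0 e0 => /(_ isT) [z [d [d0 zg]]].
exists z, (Num.min e d); first by rewrite lt_min e0.
move=> t /andP[t0]; rewrite lt_min => /andP[te td].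
have := zg t; rewrite subr0 te (lt_le_trans _ t0) ?oppr_lt0 // ger0_norm // => h.
exact: (h isT td).
Qed.

(* Projecting the coefficient matrices of [M] onto the Hermitian ones does not change
   the sum of the series, as [M t] is Hermitian. *)
Lemma Heff_germ n k (M : R -> 'M[C]_n) (e : R) : (0 < k)%N -> (k < n)%N -> 0 < e ->
  mx_analytic M (- e) e -> (forall t, 0 <= t < e -> herm_mx (M t)) ->
  exists2 h : nat -> 'M[C]_n,
    forall l, [/\ herm_mx (h l), ulsupp k (h l) & \tr (h l) = 0] &
    mgerm h (fun t => Heff k (M t)).
Proof.
move=> k0 kn e0 Man Mherm.
have /choice[co coP] : forall u : 'I_n * 'I_n, exists z, cgerm z (fun t => M t u.1 u.2).
  by move=> u; apply: analytic_cgerm e0 _; exact: Man.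
pose b l : 'M[C]_n := \matrix_(i, j) co (i, j) l.
have bM : mgerm b M.
  by move=> i j; apply: cgerm_ext (coP (i, j)) => l //; rewrite mxE.
pose hb l : 'M[C]_n := 2^-1 *: (b l + hadj (b l)).
have conj2 : conjc (2^-1 : C) = 2^-1 by rewrite -[2]/(2%:R) -toC_nat -toCV conjc_real.
have hbh l : herm_mx (hb l).
  by apply/herm_hadj; rewrite /hb hadjZ hadjD hadjK conj2 addrC.
exists (fun l => Heff k (hb l)).
  move=> l; split; [exact: herm_Heff|exact: ulsupp_Heff|exact: mxtrace_Heff].
move=> i j; have [d d0 hd] := mgerm_Heff k (mgermZ 2^-1 (mgermD bM (mgerm_hadj bM))) i j.
exists (Num.min e d); first by rewrite lt_min e0.
move=> t /andP[t0]; rewrite lt_min => /andP[te td].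
have := hd t; rewrite t0 td => /(_ isT).
rewrite (herm_hadj _).1; last by apply: Mherm; rewrite t0.
have -> // : 2^-1 *: (M t + M t) = M t.
by rewrite -mulr2n -[M t *+ 2]scaler_nat scalerA mulVf ?scale1r // pnatr_eq0.
Qed.

End HeffGerm.

(** * Equality of the four orders *)

Theorem mainTheorem7 (R : realType) (n k : nat) (eps0 : R)
    (H : R -> 'M[Cx R]_n) (H0' : 'M[Cx R]_n)
    (V0 : set 'M[Cx R]_n) (U0 : set ('M[Cx R]_n * 'M[Cx R]_n))
    (SWS SWB : 'M[Cx R]_n -> 'M[Cx R]_n) (delta : R)
    (E : 'I_(k ^ 2 - 1) -> 'M[Cx R]_n) :
  (2 <= k)%N -> (k <= n - 1)%N -> 0 < eps0 ->
  (forall t, - eps0 < t < eps0 -> herm_mx (H t)) ->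
  mx_analytic H (- eps0) eps0 ->
  Sigma k (H 0) ->
  diag_nondecr H0' -> Sigma k H0' ->
  SW_data k H0' V0 U0 SWS SWB ->
  0 < delta -> (forall t, - delta < t < delta -> V0 (H t)) ->
  traceless_onb E ->
  exists r : option nat,
    [/\ has_ord0 id (fun t => Dk k (H t)) r,
        has_ord0 id (fun t => dist_set (H t) (Sigma k)) r,
        mx_ord0 (fun t => Heff k (SWB (H t))) r &
        exists ry : 'I_(k ^ 2 - 1) -> option nat,
          (forall j, has_ord0 id (fun t => coord_along (E j) (Heff k (SWB (H t)))) (ry j))
          /\ r = \big[omin/None]_(j < k ^ 2 - 1) ry j ].
Proof.
move=> k2 kn1 eps0_gt0 hH Han _ H0d H0S [_ _ _ [VSW _] SWan] delta0 HV0 onbE.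
have k0 : (0 < k)%N by exact: leq_trans k2.
have kn : (k < n)%N by lia.
pose e := Num.min eps0 delta.
have e0 : 0 < e by rewrite lt_min eps0_gt0.
have eW (t : R) : - e < t < e -> (- eps0 < t < eps0) /\ (- delta < t < delta).
  move=> /andP[]; rewrite ltrNl lt_min => /andP[t1 t2]; rewrite lt_min => /andP[t3 t4].
  by split; rewrite ltrNl ?t1 ?t2.
have Hane : mx_analytic H (- e) e.
  move=> i j t0 /eW[t0e _]; have [co [r [r0 cr]]] := Han i j t0 t0e.
  by exists co, r; split=> // t /eW[te _]; exact: cr.
have eW0 (t : R) : 0 <= t < e -> - e < t < e.
  by move=> /andP[t0 ->]; rewrite andbT (lt_le_trans _ t0) // oppr_lt0.
have [_ SWBan] := SWan H e e0 Hane (fun t te => HV0 t (eW t te).2).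
pose B t := SWB (H t).
have SW t : 0 <= t < e -> SW_ok k H0' (H t) (SWS (H t)) (B t).
  by move=> /eW0/eW[_ /HV0 /VSW []].
have hHt t : 0 <= t < e -> herm_mx (H t) by move=> /eW0/eW[/hH].
have hB t : 0 <= t < e -> herm_mx (B t) by move=> /SW[_ []].
have [h hP hHeff] := Heff_germ k0 kn e0 SWBan hB.
(* The reference order is that of the coefficient matrices [h l]; each of the four orders is
   compared with it. *)
have [r rP] := is_order_exists (fun l => h l = 0).
have pgerm u : germ (fun l => realify (h l) u.1 u.2) (fun t => realify (Heff k (B t)) u.1 u.2).
  by apply: germ_ext (germD (germ_Re (hHeff u.1 u.2)) (germ_Im (hHeff u.1 u.2))) => l; rewrite [RHS]mxE.
(* Each [h l] is Hermitian, so it vanishes exactly when all its realified entries do. *)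
have pord : is_order (fun l => forall u : 'I_n * 'I_n, realify (h l) u.1 u.2 = 0) r.
  apply: is_order_ext rP => l; split=> [-> u|h0]; first by rewrite !mxE addr0.
  have [hl _ _] := hP l; apply: realify_eq0 => // i j; exact: (h0 (i, j)).
have sqrE t : 0 <= t < e -> \sum_(u : 'I_n * 'I_n) realify (Heff k (B t)) u.1 u.2 ^+ 2
    = \sum_(j < k) (lam (H t) j - k%:R^-1 * \sum_(j < k) lam (H t) j) ^+ 2.
  move=> te; have [_ <-] := SW_spectral k0 kn H0d H0S (hHt t te) (SW t te).
  have hh : herm_mx (Heff k (B t)) by exact: herm_Heff (hB t te).
  rewrite realify_isometry //.
  by rewrite (pair_bigA _ (fun i j => realify (Heff k (B t)) i j * realify (Heff k (B t)) i j)).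
exists r; split.
- apply: (has_ord0_near e0 _ (has_ord0_sqrt_sum_sqr pgerm (c := k%:R^-1) _ pord)).
    by move=> t te; rewrite sqrE.
  by rewrite invr_gt0 ltr0n.
- apply: (has_ord0_near e0 _ (has_ord0_sqrt_sum_sqr pgerm (c := 1) ltr01 pord)).
  move=> t te; have [gap _] := SW_spectral k0 kn H0d H0S (hHt t te) (SW t te).
  by rewrite mul1r sqrE // (dist_set_Sigma k0 kn (hHt t te) gap).
- have /choice[rr rrP] : forall u : 'I_n * 'I_n, exists o, is_order (fun l => h l u.1 u.2 = 0) o.
    by move=> u; exact: is_order_exists.
  exists (fun i j => rr (i, j)); split.
    by move=> i j; exact: cgerm_has_ord0 (hHeff i j) (rrP (i, j)).
  apply: is_order_unique rP _; last first.
    by apply: is_order_big_omin => i; apply: is_order_big_omin => j; exact: (rrP (i, j)).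
  move=> l; split=> [-> i j|h0]; first by rewrite mxE.
  by apply/matrixP => i j; rewrite [RHS]mxE; exact: h0.
(* Coordinates are linear, so the coordinates of the [h l] are the coefficients of the coordinate
   functions. *)
have ygerm j : germ (fun l => coord_along (E j) (h l)) (fun t => coord_along (E j) (Heff k (B t))).
  exact: germ_Re (cgerm_mxtrace (mgerm_mull (E j) hHeff)).
have /choice[ry ryP] : forall j, exists o, is_order (fun l => coord_along (E j) (h l) = 0) o.
  by move=> j; exact: is_order_exists.
exists ry; split; first by move=> j; exact: germ_has_ord0 (ygerm j) (ryP j).
apply: is_order_unique rP (is_order_big_omin ryP) => l; split=> [-> j|h0].
  by rewrite /coord_along mulmx0 mxtrace0.
have [hl ul tl] := hP l.
exact: traceless_onb_complete k0 (ltnW kn) onbE hl ul tl h0.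
Qed.
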